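(* Assume that for every $x^*\in E^*$ the weak limit $Q_\infty x^*=\text{weak-}\lim_{t\to\infty}Q_tx^*$ exists in $E$. Let $M>0$ be given. The following statements are equivalent: (1) $\langle Q_\infty x^*,x^*\rangle\le M\langle Qx^*,x^*\rangle$ for all $x^*\in E^*$; (2) $\|S_\infty(t)\|_{H_\infty}\le\exp\bigl(-\frac{t}{2M}\bigr)$ for all $t\ge0$.
   Context: $E$ is a real Banach space with dual $E^*$; $S=\{S(t)\}_{t\ge0}$ is a $C_0$-semigroup of bounded linear operators on $E$ with adjoint operators $S^*(t)$ on $E^*$. $H$ is a real Hilbert space with a continuous injective linear map $i:H\to E$, and $Q:=i\circ i^*\in\mathcal L(E^*,E)$ ($H$ being identified with its dual). For $t>0$, $Q_t x^*:=\int_0^t S(s)QS^*(s)x^*\,ds$ for $x^*\in E^*$. An operator $R\in\mathcal L(E^*,E)$ is positive if $\langle Rx^*,x^*\rangle\ge0$ and symmetric if $\langle Rx^*,y^*\rangle=\langle Ry^*,x^*\rangle$ for all $x^*,y^*\in E^*$. For such $R$, its reproducing kernel Hilbert space (RKHS) is the completion $H_R$ of the range of $R$ for the inner product $(Rx^*,Ry^* )\mapsto\langle Rx^*,y^*\rangle$; the inclusion of the range of $R$ in $E$ extends to a continuous injection $i_R:H_R\to E$ with $R=i_R\circ i_R^*$, and $H_R$ is identified with its image in $E$. $H_\infty$ is the RKHS of $Q_\infty$. The space $H_\infty$ is invariant under $S$, and the restriction $S_\infty=\{S_\infty(t)\}_{t\ge0}$ of $S$ to $H_\infty$ is a $C_0$-semigroup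 of contractions on $H_\infty$; $\|S_\infty(t)\|_{H_\infty}$ is the operator norm on $H_\infty$. *)

(* Defs.v *)
From HB Require Import structures.
From mathcomp Require Import all_boot all_order all_algebra sesquilinear.
From mathcomp Require Import all_classical all_reals all_analysis.

Set Implicit Arguments.
Unset Strict Implicit.
Unset Printing Implicit Defensive.

Import Order.TTheory GRing.Theory Num.Theory.
Import numFieldNormedType.Exports.

Local Open Scope classical_set_scope.
Local Open Scope ring_scope.

(* Positive definiteness of [inner] follows from [inner_norm]. *)
HB.mixin Record hasInnerProduct (R : realType) H
    & CompleteNormedModule R H := {
  inner : {symmetric H} ;
  inner_norm : forall h : H, inner h h = `|h| ^+ 2
}.

#[short(type="hilbertType")]
HB.structure Definition Hilbert (R : realType) :=
  {H of hasInnerProduct R H & CompleteNormedModule R H}.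

Record bounded_op (R : realType) (U V : normedModType R) := BoundedOp {
  bop :> {linear U -> V} ;
  bop_continuous : continuous bop
}.

Notation dual E := (bounded_op E (GRing.regular _)).

Section operators.
Context {R : realType}.

Lemma bcomp_continuous (U V W : normedModType R)
    (g : bounded_op V W) (f : bounded_op U V) :
  continuous (fun u : U => g (f u) : W).
Proof.
by move=> u; apply: continuous_comp; exact: bop_continuous.
Qed.

Definition bcomp (U V W : normedModType R)
    (g : bounded_op V W) (f : bounded_op U V) : bounded_op U W :=
  @BoundedOp R U W (bop g \o bop f) (@bcomp_continuous U V W g f).

Definition dual_op (U V : normedModType R) (T : bounded_op U V)
  (x : dual V) : dual U := bcomp x T.

(* The Hilbert space H being identified with its dual, [hadjoint i] is
   i^* : E^* -> H; the vector chosen here exists and is unique by the Riesz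
   representation theorem. *)
Definition hadjoint (E : normedModType R) (H : hilbertType R)
    (i : bounded_op H E) (x : dual E) : H :=
  xget 0 [set k | forall h, inner k h = x (i h)].

Definition opnorm (U V : normedModType R) (T : U -> V) : \bar R :=
  ereal_sup [set `|T u|%:E | u in [set u | `|u| <= 1]].

(* The restriction of T to the space K, seen as a subspace of E through
   the injection iK. *)
Definition restriction (K E : normedModType R) (iK : bounded_op K E)
    (T : bounded_op E E) (k : K) : K :=
  xget 0 [set k' | iK k' = T (iK k)].

Definition weak_lim (E : normedModType R) (f : R -> E) (v : E) :=
  forall y : dual E, y (f t) @[t --> +oo%R] --> y v.

(* S is indexed by the whole of R, but its values at negative times are
   unconstrained and never used. *)
Definition C0_semigroup (E : normedModType R) (S : R -> bounded_op E E) :=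
  [/\ forall v, S 0 v = v,
      forall s t, 0 <= s -> 0 <= t -> forall v, S (s + t) v = S s (S t v) &
      forall v, S t v @[t --> 0^'+] --> v].

End operators.

Section bochner.
Context {R : realType} {E : normedModType R} {d : measure_display}
        {T : measurableType d}.
Variables (mu : {measure set T -> \bar R}) (D : set T).

Definition simple (s : T -> E) :=
  finite_set (range s) /\
  forall y, measurable (D `&` s @^-1` [set y]) /\
    (y != 0 -> (mu (D `&` s @^-1` [set y]) < +oo)%E).

Definition simple_integral (s : T -> E) : E :=
  \sum_(y \in range s) fine (mu (D `&` s @^-1` [set y])) *: y.

(* Pointwise convergence is strong measurability of f; it also makes the
   integrals of the norms integrals of measurable functions. *)
Definition is_bochner (f : T -> E) (v : E) :=
  exists s : nat -> T -> E,
    [/\ forall n, simple (s n),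
        forall x, D x -> s n x @[n --> \oo] --> f x,
        (\int[mu]_(x in D) `|f x - s n x|%:E)%E @[n --> \oo] --> 0%E &
        simple_integral (s n) @[n --> \oo] --> v].

Definition bochner (f : T -> E) : E := xget 0 (is_bochner f).

End bochner.

Section covariance.
Context {R : realType} {E : completeNormedModType R} {H : hilbertType R}.
Variables (S : R -> bounded_op E E) (i : bounded_op H E).

Definition Qop (x : dual E) : E := i (hadjoint i x).

Definition Qt (t : R) (x : dual E) : E :=
  bochner (@lebesgue_measure R) `[0, t] (fun s => S s (Qop (dual_op (S s) x))).

(* By Hahn-Banach there is at most one weak limit. *)
Definition Qinf (x : dual E) : E := xget 0 (weak_lim (Qt ^~ x)).

End covariance.

(* [J], used on the range of Rop only, isometrically embeds that range, with
   the inner product (Rop x, Rop y) |-> <Rop x, y>, onto a dense subspace of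
   the Hilbert space K: thus K is its completion (linearity of J on the range
   is automatic), and iK is the continuous extension of the inclusion of the
   range in E.  Injectivity of iK and the factorization of Rop through iK and
   its adjoint follow. *)
Definition is_rkhs (R : realType) (E : completeNormedModType R)
    (Rop : dual E -> E) (K : hilbertType R) (iK : bounded_op K E) :=
  exists J : E -> K,
    [/\ forall x y : dual E, inner (J (Rop x)) (J (Rop y)) = y (Rop x),
        dense (range (J \o Rop)) &
        forall x, iK (J (Rop x)) = Rop x].

(* Main.v *)
Require Import Defs.
From HB Require Import structures.
From mathcomp Require Import all_boot all_order all_algebra sesquilinear.
From mathcomp Require Import all_classical all_reals all_analysis.
From mathcomp Require Import finmap measurable_realfun.
From mathcomp Require Import ring lra.

(** Write [i^*] and [iK^*] for the adjoints [hadjoint i] and [hadjoint iinf].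
    By [rkhs_factor] the form of Qinf is [x (Qinf x) = |iK^* x|^2], and that of
    Q is [x (Q x) = |i^* x|^2].  Since the form of Q_t is the integral of
    [|i^* S(s)^* x|^2] over [0, t], cutting that integral in two and letting the
    upper bound tend to infinity gives the energy identity
    ([adjoint_orbit_decay])

      |iK^* S(t)^* x|^2 = |iK^* x|^2 - x (Q_t x).

    The adjoint of the restriction of S(t) maps [iK^* x] to [iK^* S(t)^* x], so
    that the norm estimate on the restriction says that
    [|iK^* S(t)^* x| <= exp (- t / 2M) |iK^* x|] for all x ([opnorm_restriction]).

    The inequality between the forms implies decay: it bounds the integrand below
    by [1/M] times the nonincreasing function [|iK^* S(s)^* x|^2], hence
    [(1 + t/M) |iK^* S(t)^* x|^2 <= |iK^* x|^2]; applied to n steps of length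
    t/n, this tends to the exponential estimate ([dominated_decay]).

    Conversely, dividing the energy identity by t and letting t tend to 0 would
    give the inequality between the forms if [|i^* S(s)^* x|] were continuous at
    0, but [i^* S(s)^* x] is only weakly continuous in s. The argument is valid
    for the functionals y whose orbit [S(s)^* y] is Lipschitz in norm near 0
    ([decay_regular_dominated]); the averages of [S(s)^* x] over short intervals
    are such functionals, and they converge weak-star to x ([regular_dense]).
    The inequality passes from them to all functionals by duality rather than by
    approximation: it lets every k in the reproducing kernel space be
    represented by some h in H with [|h| <= sqrt M |k|] and [y (i h) = y (iinf
    k)] for all regular y, so that [x (i h) = x (iinf k)] for all x
    ([decay_dominated]).

    Two points need care.  The integrand [S(s) Q S(s)^* x] has to be strongly
    measurable at every point for [Q_t x] to be a Bochner integral at all: the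
    projections of the weakly continuous curve [i^* S(s)^* x] onto the spans of
    finitely many of its values at rational times are norm continuous and
    converge pointwise to the curve ([weakly_continuous_approx]).  And identities
    in E are tested against functionals, which requires the Hahn-Banach theorem
    ([hahn_banach]). *)

Set Implicit Arguments.
Unset Strict Implicit.
Unset Printing Implicit Defensive.

Import Order.TTheory GRing.Theory Num.Theory.
Import numFieldNormedType.Exports.

Local Open Scope classical_set_scope.
Local Open Scope ring_scope.

(** * Hilbert spaces *)

Section convergence.
Context {R : realType}.

Lemma cauchy_cvgn (V : completeNormedModType R) (u : nat -> V) :
  (forall e, 0 < e -> exists N, forall n, (N <= n)%N -> `|u N - u n| < e) ->
  cvgn u.
Proof.
move=> cu; apply/cauchy_cvgP; apply: cauchy_exP => e e0.
have [N HN] := cu _ e0; exists (u N); exists N => // n /= Nn.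
by rewrite -ball_normE /=; exact: HN.
Qed.

Lemma cvg_dist_squeeze (T : Type) (F : set_system T) (FF : Filter F)
    (V : normedModType R) (f : T -> V) (l : V) (g : T -> R) :
  (\near F, `|l - f F| <= g F) -> g @ F --> (0 : R) -> f @ F --> l.
Proof.
move=> fg g0; apply/cvgrPdist_lt => e e0.
near=> x; apply: (@le_lt_trans _ _ (g x)); first by near: x.
by near: x; apply: (cvgr_lt _ g0).
Unshelve. all: by end_near. Qed.

End convergence.

Section hilbert.
Context {R : realType} {H : hilbertType R}.
Implicit Types u v w : H.

Lemma innerC u v : inner u v = inner v u.
Proof. by rewrite hermC /= expr0 mul1r. Qed.

Lemma innerDl u v w : inner (u + v) w = inner u w + inner v w.
Proof. by rewrite linearDl. Qed.

Lemma innerZl a v w : inner (a *: v) w = a * inner v w.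
Proof. by rewrite linearZl_LR. Qed.

Lemma innerDr u v w : inner w (u + v) = inner w u + inner w v.
Proof. by rewrite linearDr. Qed.

Lemma innerZr a v w : inner w (a *: v) = a * inner w v.
Proof. by rewrite linearZr. Qed.

Lemma innerNl v w : inner (- v) w = - inner v w.
Proof. by rewrite -scaleN1r innerZl mulN1r. Qed.

Lemma innerNr v w : inner w (- v) = - inner w v.
Proof. by rewrite -scaleN1r innerZr mulN1r. Qed.

Lemma inner0l w : inner 0 w = 0.
Proof. by rewrite -(scale0r w) innerZl mul0r. Qed.

Definition innerE := (innerDl, innerDr, innerNl, innerNr, innerZl, innerZr).

Lemma inner_ge0 u : 0 <= inner u u.
Proof. by rewrite inner_norm sqr_ge0. Qed.

Lemma inner_eq0 u : inner u u = 0 -> u = 0.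
Proof. by move=> /eqP; rewrite inner_norm sqrf_eq0 normr_eq0 => /eqP. Qed.

Lemma inner_inj u v : (forall w, inner u w = inner v w) -> u = v.
Proof.
move=> uv; apply/subr0_eq/inner_eq0.
by rewrite innerDl innerNl uv subrr.
Qed.

Lemma cauchy_schwarz u v : `|inner u v| <= `|u| * `|v|.
Proof.
rewrite -(ler_pXn2r (n := 2)) ?nnegrE ?mulr_ge0// exprMn -!inner_norm.
rewrite real_normK ?num_real//.
have [/inner_eq0 ->|v0] := eqVneq (inner v v) 0.
  by rewrite innerC inner0l expr0n mulr_ge0 ?inner_ge0.
have vp : 0 < inner v v by rewrite lt0r v0 inner_ge0.
rewrite -subr_ge0.
have := inner_ge0 (inner v v *: u - inner u v *: v).
rewrite !innerE (innerC v u) => h.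
by rewrite -(pmulr_rge0 _ vp); apply: le_trans h _; lra.
Qed.

Lemma continuous_innerl w : continuous (fun u => inner u w : R).
Proof.
move=> u; apply: (@cvg_dist_squeeze _ _ _ _ _ _ _ (fun v => `|u - v| * `|w|)).
  by apply: nearW => v; rewrite -innerNl -innerDl; exact: cauchy_schwarz.
rewrite -[X in _ --> X](mul0r `|w|); apply: cvgMr_tmp.
have -> : (0 : R) = `|u - u| by rewrite subrr normr0.
by apply: cvg_norm; apply: cvgB; [exact: cvg_cst|exact: cvg_id].
Qed.

Lemma continuous_innerr w : continuous (fun u => inner w u : R).
Proof.
rewrite (_ : (fun u => _) = fun u => inner u w); first exact: continuous_innerl.
by apply/funext => u; rewrite innerC.
Qed.

Lemma cvg_innerl (T : Type) (F : set_system T) {FF : Filter F} (f : T -> H) u w :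
  f @ F --> u -> (fun t => inner (f t) w) @ F --> (inner u w : R).
Proof.
move=> fu; apply: (@continuous_cvg _ _ _ _ _ f (fun u => inner u w : R)) fu.
exact: continuous_innerl.
Qed.

(** The Riesz representation theorem along a map A: the representing vector is the
    limit of [A x_n] along a minimizing sequence of [|A x|^2 - 2 l x], which is
    Cauchy by the parallelogram law. The domain of A is a bare type, closed under
    linear combinations as seen through A and l, because bounded functionals do
    not come with a vector space structure. *)
Lemma riesz_along (V : Type) (A : V -> H) (l : V -> R) (x0 : V) (C : R) :
  (forall a x y, exists z, A z = a *: A x + A y /\ l z = a * l x + l y) ->
  (forall x, `|l x| <= C * `|A x|) ->
  0 <= C ->
  exists h, `|h| <= C /\ forall x, inner h (A x) = l x.
Proof.
move=> lin lC C0.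
have lin2 a b x y :
    exists z, A z = a *: A x + b *: A y /\ l z = a * l x + b * l y.
  have [z0 [Az0 lz0]] := lin (- 1) x x.
  have [z1 [Az1 lz1]] := lin b y z0.
  have [z [Az lz]] := lin a x z1; exists z.
  by rewrite Az Az1 Az0 lz lz1 lz0 scaleN1r addNr addr0; split => //; lra.
pose F x := inner (A x) (A x) - 2 * l x.
(* The bound on l completes the square: [F x >= (|A x| - C)^2 - C^2]. *)
have Flb x : - C ^+ 2 <= F x.
  rewrite /F inner_norm.
  have := lC x; have : l x <= `|l x| by exact: ler_norm.
  have := sqr_ge0 (`|A x| - C); nra.
have hasF : has_inf (range F).
  by split; [exists (F x0), x0|exists (- C ^+ 2) => _ [x _ <-]].
pose m := inf (range F).
have mF x : m <= F x by apply: ge_inf; [exact: hasF.2|exists x].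
have /choice[x Hx] : forall n, exists x, F x < m + n.+1%:R^-1.
  move=> n; have e0 : 0 < n.+1%:R^-1 :> R by rewrite invr_gt0.
  by have [_ [x _ <-] Fx] := inf_adherent e0 hasF; exists x.
have Adist n p : `|A (x n) - A (x p)| ^+ 2 <= 2 * (n.+1%:R^-1 + p.+1%:R^-1).
  have [z [Az lz]] := lin2 2^-1 2^-1 (x n) (x p).
  have := mF z; have := Hx n; have := Hx p.
  rewrite -inner_norm /F Az lz !innerE (innerC (A (x p))).
  by move: (n.+1%:R^-1) (p.+1%:R^-1) => e1 e2; lra.
have cA : cvgn (A \o x).
  apply: cauchy_cvgn => e e0.
  have [N _ HN] : \forall N \near \oo, (N.+1%:R^-1 : R) < e ^+ 2 / 4.
    have e2 : 0 < e ^+ 2 / 4 by rewrite divr_gt0// exprn_gt0.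
    exact: (near_infty_natSinv_lt (PosNum e2)).
  exists N => n Nn /=.
  rewrite -(ltr_pXn2r (n := 2)) ?nnegrE ?(ltW e0)//.
  apply: le_lt_trans (Adist _ _) _.
  have := HN _ (leqnn N); have := HN _ Nn => /=.
  by move: (n.+1%:R^-1) (N.+1%:R^-1) => e1 e2; lra.
pose h := limn (A \o x).
have Ah : A \o x @ \oo --> h by exact: cA.
have inv0 : (fun n => n.+1%:R^-1 : R) @ \oo --> (0 : R) by exact: cvg_harmonic.
have dn y n : (inner (A (x n)) (A y) - l y) ^+ 2 <=
    n.+1%:R^-1 * (inner (A y) (A y) + 1).
  set d := inner _ _ - _; set b := inner (A y) _.
  have b0 : 0 <= b := inner_ge0 _.
  (* The step that minimizes the quadratic [- 2 q d + q^2 b] is d / b; taking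
     b + 1 instead keeps the denominator positive and still gains enough. *)
  pose q := d / (b + 1).
  have dq : d = q * (b + 1) by rewrite /q divfK// gt_eqF// ltr_wpDl.
  have [z [Az lz]] := lin2 1 (- q) (x n) y.
  have := mF z; have := Hx n; rewrite /F Az lz !innerE (innerC (A y)).
  have -> : inner (A (x n)) (A y) = d + l y by rewrite /d subrK.
  rewrite -/b; move: (n.+1%:R^-1) => e1 Fx Fz.
  have e1q : q ^+ 2 * (b + 2) <= e1 by nra.
  rewrite dq exprMn.
  apply: le_trans (ler_wpM2r _ e1q); last by rewrite addr_ge0.
  have : 0 <= q ^+ 2 * (b + 1) by rewrite mulr_ge0 ?sqr_ge0 ?addr_ge0.
  by nra.
have hl y : inner h (A y) = l y.
  have h1 : (fun n => inner (A (x n)) (A y)) @ \oo --> inner h (A y).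
    exact: cvg_innerl.
  apply: (cvg_unique (@Rhausdorff R) h1) => //.
  pose b := inner (A y) (A y) + 1.
  have b0 : 0 <= b by rewrite addr_ge0 ?inner_ge0.
  apply: (@cvg_dist_squeeze _ _ _ _ _ _ _ (fun n => Num.sqrt (n.+1%:R^-1 * b))).
    apply: nearW => n; rewrite distrC -sqrtr_sqr ler_sqrt ?dn//.
    by rewrite mulr_ge0.
  rewrite -[X in _ --> X](@sqrtr0 R) -(mul0r b).
  apply: (@continuous_cvg _ R R \oo _ (fun n => n.+1%:R^-1 * b) Num.sqrt).
    exact: sqrt_continuous.
  exact: cvgMr_tmp.
exists h; split => //.
have [->|h0] := eqVneq h 0; first by rewrite normr0.
have h1 : (fun n => inner h (A (x n))) @ \oo --> inner h h.
  under eq_fun do rewrite innerC.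
  exact: cvg_innerl.
have h2 : (fun n => C * `|A (x n)|) @ \oo --> C * `|h|.
  by apply: cvgMl_tmp; exact: cvg_norm.
have : inner h h <= C * `|h|.
  apply: ler_cvg_to h1 h2 _ => //.
  by apply: nearW => n; rewrite hl (le_trans (ler_norm _)).
by rewrite inner_norm expr2 ler_pM2r // normr_gt0.
Qed.
End hilbert.

(** * Bounded operators and the Hahn-Banach theorem *)

Section bounded.
Context {R : realType}.

(** Proof irrelevance identifies the linearity and continuity proofs. *)
Lemma bop_ext (U V : normedModType R) (f g : bounded_op U V) :
  (forall v, f v = g v) -> f = g.
Proof.
case: f => f cf; case: g => g cg /= fg.
have e : f = g.
  have : (f : U -> V) = g by apply/funext.
  case: f {cf fg} => f cf; case: g {cg} => g cg /= fg; subst g.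
  congr GRing.Linear.Pack; case: cf cg => [[a1] [b1]] [[a2] [b2]].
  by rewrite (Prop_irrelevance a1 a2) (Prop_irrelevance b1 b2).
by move: cf; rewrite e => cf; congr BoundedOp; exact: Prop_irrelevance.
Qed.

Lemma bop_bound (U V : normedModType R) (f : bounded_op U V) :
  exists C, 0 < C /\ forall v, `|f v| <= C * `|v|.
Proof.
have /linear_bounded_continuous/linear_boundedP := @bop_continuous _ _ _ f.
by move=> /pinfty_ex_gt0[C C0 fC]; exists C.
Qed.

Lemma bop_build (U V : normedModType R) (f : U -> V) (C : R) :
  linear f -> (forall v, `|f v| <= C * `|v|) ->
  exists g : bounded_op U V, forall v, g v = f v.
Proof.
move=> lf fC.
pose F : {linear U -> V} := HB.pack f (GRing.isLinear.Build _ _ _ _ _ lf).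
have cF : continuous F.
  apply/linear_bounded_continuous/linear_boundedP.
  near=> r => v; apply: le_trans (fC v) _.
  by rewrite ler_wpM2r//; near: r; exact: nbhs_pinfty_ge.
by exists (BoundedOp cF).
Unshelve. all: by end_near. Qed.

Lemma bop_lin (U V : normedModType R) (f g : bounded_op U V) (a : R) :
  exists h : bounded_op U V, forall v, h v = a *: f v + g v.
Proof.
have [C [C0 fC]] := bop_bound f; have [D [D0 gD]] := bop_bound g.
apply: (@bop_build _ _ _ (`|a| * C + D)) => [c u v|v].
  rewrite (linearP f) (linearP g) !scalerDr !scalerA (mulrC a).
  by rewrite addrACA.
rewrite mulrDl -mulrA (le_trans (ler_normD _ _))// normrZ lerD//.
by rewrite ler_wpM2l.
Qed.

End bounded.

Section hahn_banach.
Context {R : realType} {E : normedModType R}.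
Implicit Types (p q : E -> R) (u v w : E).

Definition sublinear p :=
  (forall u v, p (u + v) <= p u + p v) /\
  (forall a v, 0 < a -> p (a *: v) <= a * p v).

Lemma sublinear0 p : sublinear p -> p 0 = 0.
Proof.
case=> _ pZ; apply/eqP; rewrite eq_le.
have : 0 < 2^-1 :> R by rewrite invr_gt0.
have : 0 < 2 :> R by [].
by move=> /(pZ _ 0) + /(pZ _ 0); rewrite !scaler0; lra.
Qed.

Lemma sublinearZ p a v : sublinear p -> 0 <= a -> p (a *: v) = a * p v.
Proof.
move=> sp; rewrite le_eqVlt => /predU1P[<-|a0].
  by rewrite scale0r mul0r sublinear0.
apply/eqP; rewrite eq_le (sp.2 _ _ a0)/= -ler_pdivlMl//.
have ai : 0 < a^-1 by rewrite invr_gt0.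
by have := sp.2 _ (a *: v) ai; rewrite scalerA mulVf ?gt_eqF// scale1r.
Qed.

Lemma sublinear_lb p v : sublinear p -> - p (- v) <= p v.
Proof.
move=> sp; have := sp.1 v (- v); rewrite subrr sublinear0//; lra.
Qed.

(** The largest sublinear functional below p whose value at [- w] is at most
    [- p w], when p is sublinear. *)
Definition twist p w v :=
  inf [set p (v + t *: w) - t * p w | t in [set t | 0 <= t]].

Lemma twist_le p w v t : sublinear p -> 0 <= t ->
  twist p w v <= p (v + t *: w) - t * p w.
Proof.
move=> sp t0; apply: ge_inf; last by exists t.
exists (- p (- v)) => _ [s s0 <-].
rewrite lerBrDr -(sublinearZ _ sp)//.
have := sp.1 (- v) (v + s *: w); rewrite addrA addNr add0r; lra.
Qed.

Lemma le_twist p w v c :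
  (forall t, 0 <= t -> c <= p (v + t *: w) - t * p w) -> c <= twist p w v.
Proof.
move=> h; apply: lb_le_inf; first by exists (p (v + 0 *: w) - 0 * p w); exists 0 => /=.
by move=> _ [t t0 <-]; exact: h.
Qed.

(** Together with [twist_le] at t = 1: a sublinear p can always be lowered to
    a sublinear functional with value at most [- p w] at [- w].  A minimal p is
    therefore odd. *)
Lemma twist_sublinear p w : sublinear p -> sublinear (twist p w).
Proof.
move=> sp; split=> [u v|a v a0].
  rewrite -lerBlDr; apply: le_twist => t t0.
  rewrite lerBlDl -lerBlDr; apply: le_twist => s s0.
  have := @twist_le p w (u + v) (t + s) sp (addr_ge0 t0 s0).
  have := sp.1 (u + t *: w) (v + s *: w).
  by rewrite addrACA -scalerDl; lra.
rewrite -ler_pdivrMl//; apply: le_twist => t t0.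
rewrite ler_pdivrMl//.
have := @twist_le p w (a *: v) (a * t) sp (mulr_ge0 (ltW a0) t0).
by rewrite -scalerA -scalerDr (sublinearZ (v + t *: w) sp (ltW a0)); lra.
Qed.

(** Zorn's lemma: along a chain of sublinear functionals below p0 the pointwise
    infimum is finite, being at least [- p0 (- v)], and sublinear. *)
Lemma minimal_sublinear p0 : sublinear p0 ->
  exists p, [/\ sublinear p, forall v, p v <= p0 v &
    forall q, sublinear q -> (forall v, q v <= p v) -> q = p].
Proof.
move=> sp0.
pose T := {p : E -> R | sublinear p /\ forall v, p v <= p0 v}.
pose le (p q : T) := `[< forall v, sval q v <= sval p v >].
have [| | |A totA|[p [sp pp0]] pmin] := @Zorn T le.
- by move=> p; apply/asboolP.
- move=> p q r /asboolP qp /asboolP rq; apply/asboolP => v.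
  exact: le_trans (qp v).
- move=> [p Pp] [q Pq] /asboolP /= qp /asboolP /= pq.
  by apply: eq_exist; apply/funext => v; apply/eqP; rewrite eq_le pq qp.
- have [[r Ar]|A0] := pselect (A !=set0); last first.
    exists (exist _ p0 (conj sp0 (fun=> lexx _))) => s As.
    by exfalso; apply: A0; exists s.
  pose q v := inf [set sval s v | s in A].
  have qle s v : A s -> q v <= sval s v.
    move=> As; apply: ge_inf; last by exists s.
    exists (- p0 (- v)) => _ [[t [st tp0]] _ <-] /=.
    by apply: le_trans (sublinear_lb v st); rewrite lerN2.
  have le_q c v : (forall s, A s -> c <= sval s v) -> c <= q v.
    move=> h; apply: lb_le_inf; first by exists (sval r v); exists r.
    by move=> _ [s As <-]; exact: h.
  have sq : sublinear q.
    split=> [u v|a v a0].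
      rewrite -lerBlDr; apply: (le_q _ _) => s As.
      rewrite lerBlDl -lerBlDr; apply: (le_q _ _) => t At; rewrite lerBlDl.
      have [/asboolP h|/asboolP h] := totA _ _ As At.
        apply: le_trans (qle t _ At) _; apply: le_trans ((svalP t).1.1 _ _) _.
        by rewrite lerD.
      apply: le_trans (qle s _ As) _; apply: le_trans ((svalP s).1.1 _ _) _.
      by rewrite lerD.
    rewrite -ler_pdivrMl//; apply: (le_q _ _) => s As; rewrite ler_pdivrMl//.
    by apply: le_trans (qle s _ As) _; exact: (svalP s).1.2.
  have qp0 v : q v <= p0 v by apply: le_trans (qle r v Ar) ((svalP r).2 v).
  exists (exist _ q (conj sq qp0)) => s As; apply/asboolP => v /=.
  exact: qle.
- exists p; split=> // q sq qp.
  have qp0 v : q v <= p0 v by apply: le_trans (pp0 v).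
  have := pmin (exist _ q (conj sq qp0)).
  have h : le (exist _ p (conj sp pp0)) (exist _ q (conj sq qp0)) by apply/asboolP.
  by move=> /(_ h) [].
Qed.

(** A minimal sublinear functional equals all its twists, which makes it
    additive and odd, hence linear.  Starting from the norm twisted along v0
    forces the value [|v0|] at v0. *)
Lemma hahn_banach v0 :
  exists f : dual E, f v0 = `|v0| /\ forall v, `|f v| <= `|v|.
Proof.
have sn : sublinear (fun v : E => `|v|).
  by split=> [u v|a v a0]; [exact: ler_normD|rewrite normrZ gtr0_norm].
have [p [sp pp0 pmin]] := minimal_sublinear (twist_sublinear v0 sn).
have twp w : twist p w = p.
  apply: pmin => [|v]; first exact: twist_sublinear.
  by have := @twist_le p w v 0 sp (lexx _); rewrite scale0r addr0 mul0r subr0.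
have pN v : p (- v) = - p v.
  apply/eqP; rewrite eq_le -[leRHS]opprK lerNl opprK.
  have := @twist_le p v (- v) 1 sp ler01.
  rewrite twp scale1r addNr sublinear0// mul1r sub0r => ->/=.
  by have := sublinear_lb v sp; rewrite lerNl.
have pD u v : p (u + v) = p u + p v.
  apply/eqP; rewrite eq_le sp.1/=.
  have := @twist_le p v u 1 sp ler01.
  by rewrite twp scale1r mul1r lerBrDr.
have pZ a v : p (a *: v) = a * p v.
  have [a0|a0] := leP 0 a; first exact: sublinearZ.
  rewrite -[a]opprK scaleNr pN sublinearZ ?mulNr//.
  by rewrite oppr_ge0 ltW.
have lp : linear (p : E -> R^o) by move=> a u v; rewrite pD pZ.
have ple v : p v <= `|v|.
  apply: le_trans (pp0 v) _.
  by have := @twist_le _ v0 v 0 sn (lexx _); rewrite scale0r addr0 mul0r subr0.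
have pabs v : `|p v| <= 1 * `|v|.
  by rewrite mul1r ler_norml ple andbT lerNl -pN -(normrN v).
have [f fE] := @bop_build R E R^o p 1 lp pabs.
exists f; split; last by move=> v; rewrite fE -[leRHS]mul1r.
rewrite fE; apply/eqP; rewrite eq_le ple /=.
have := pp0 (- v0); have := @twist_le _ v0 (- v0) 1 sn ler01.
by rewrite scale1r addNr normr0 mul1r sub0r pN; lra.
Qed.

Lemma dual_separates u v : (forall f : dual E, f u = f v) -> u = v.
Proof.
move=> uv; apply/subr0_eq/eqP; rewrite -normr_eq0.
by have [f [<- _]] := hahn_banach (u - v); rewrite linearB uv subrr.
Qed.

End hahn_banach.

(** * Strong approximation of weakly continuous curves *)

Section resid.
Context {R : realType} {H : hilbertType R}.
Variable a : nat -> H.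
Implicit Types u v w : H.

(** The Gram-Schmidt process in terms of residuals: [resid n u] is u minus its
    projection onto the span of [a 0], ..., [a (n - 1)].  A direction that vanishes
    because [a m] depends on its predecessors contributes 0. *)
Fixpoint resid n u : H :=
  if n is m.+1 then
    let d := resid m (a m) in
    resid m u - (inner (resid m u) d / inner d d) *: d
  else u.

Let d n := resid n (a n).

Lemma resid_orth n k u : (k < n)%N -> inner (resid n u) (d k) = 0.
Proof.
elim: n u => // n IH u; rewrite ltnS leq_eqVlt => /predU1P[->|kn].
  rewrite /= -/(d n) !innerE.
  have [d0|d0] := eqVneq (inner (d n) (d n)) 0; last by rewrite divfK// subrr.
  by rewrite d0 mulr0 (inner_eq0 d0) innerC inner0l subrr.
by rewrite /= -/(d n) !innerE !IH// mulr0 subrr.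
Qed.

(** The vector [u - resid n u] is a combination of the first n directions. *)
Lemma inner_resid n u w :
  (forall k, (k < n)%N -> inner w (d k) = 0) -> inner w (resid n u) = inner w u.
Proof.
elim: n u => // n IH u wd; rewrite /= -/(d n) !innerE (wd n)// mulr0 subr0.
by apply: IH => k kn; apply: wd; exact: ltnW.
Qed.

Lemma resid_pythagoras n m u : (n <= m)%N ->
  `|resid n u - resid m u| ^+ 2 = `|resid n u| ^+ 2 - `|resid m u| ^+ 2.
Proof.
move=> nm; rewrite -!inner_norm !innerE (innerC (resid n u) (resid m u)).
have orth k : (k < m)%N -> inner (resid m u) (d k) = 0 by exact: resid_orth.
rewrite (@inner_resid n u (resid m u)) => [|k kn]; last first.
  by apply: orth; exact: leq_trans nm.
by rewrite (@inner_resid m u (resid m u))//; lra.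
Qed.

(** The squared distances between residuals are differences of a nonincreasing
    sequence of nonnegative numbers. *)
Lemma resid_cvg u : cvgn (resid ^~ u).
Proof.
apply: cauchy_cvgn => e e0.
pose A := range (fun n => `|resid n u| ^+ 2).
have hA : has_inf A.
  by split; [exists (`|resid 0 u| ^+ 2), 0%N|exists 0 => _ [n _ <-]; rewrite sqr_ge0].
have e20 : 0 < e ^+ 2 by rewrite exprn_gt0.
have [_ [N _ <-] Ne] := inf_adherent e20 hA.
exists N => n Nn; rewrite -(ltr_pXn2r (n := 2)) ?nnegrE ?(ltW e0)//.
rewrite resid_pythagoras// ltrBlDl; apply: lt_le_trans Ne _.
by rewrite lerD2r; apply: ge_inf; [exact: hA.2|exists n].
Qed.

(** The limit w of the residuals is orthogonal to every direction, hence to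
    every [a n], hence to u, hence to itself. *)
Lemma resid_cvg0 u :
  (forall w, (forall n, inner w (a n) = 0) -> inner w u = 0) ->
  resid ^~ u @ \oo --> (0 : H).
Proof.
move=> ua; pose w := limn (resid ^~ u).
have cw : resid ^~ u @ \oo --> w by exact: resid_cvg.
have wd k : inner w (d k) = 0.
  have h1 : (fun n => inner (resid n u) (d k)) @ \oo --> (inner w (d k) : R).
    exact: cvg_innerl.
  have h2 : (fun n => inner (resid n u) (d k)) @ \oo --> (0 : R).
    apply: cvg_near_cst.
    by exists k.+1 => // n /= kn; rewrite resid_orth.
  exact: (cvg_unique (@Rhausdorff R) h1 h2).
have wu : inner w u = 0.
  by apply: ua => n; rewrite -(@inner_resid n)//; exact: wd.
suff <- : w = 0 by [].
apply: inner_eq0; have h1 : (fun n => inner (resid n u) w) @ \oo --> (inner w w : R).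
  exact: cvg_innerl.
have h2 : (fun n => inner (resid n u) w) @ \oo --> (0 : R).
  apply: cvg_near_cst; apply: nearW => n.
  by rewrite innerC inner_resid ?wu.
exact: (cvg_unique (@Rhausdorff R) h1 h2).
Qed.

Lemma resid_weak_continuous (g : R -> H) n w :
  (forall w, continuous (fun s => inner (g s) w : R)) ->
  continuous (fun s => inner (resid n (g s)) w : R).
Proof.
move=> cg; elim: n w => [w|n IH w] /= ; first exact: cg.
rewrite -/(d n).
rewrite (_ : (fun s => _) = fun s => inner (resid n (g s)) w -
    inner (resid n (g s)) (d n) / inner (d n) (d n) * inner (d n) w).
  by move=> s; apply: cvgB; [|apply: cvgMr_tmp; apply: cvgMr_tmp]; exact: IH.
by apply/funext => s; rewrite !innerE.
Qed.

(** The curve [g - resid n g] has scalar coefficients, inner products with g, in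
    finitely many fixed directions. *)
Lemma resid_continuous (g : R -> H) n :
  (forall w, continuous (fun s => inner (g s) w : R)) ->
  continuous (fun s => g s - resid n (g s)).
Proof.
move=> cg; elim: n => [|n IH] /=.
  rewrite (_ : (fun s => _) = fun=> 0); first by move=> s; exact: cvg_cst.
  by apply/funext => s; rewrite subrr.
rewrite -/(d n) (_ : (fun s => _) = fun s => g s - resid n (g s) +
    (inner (resid n (g s)) (d n) / inner (d n) (d n)) *: d n).
  move=> s; apply: cvgD; first exact: IH.
  by apply: cvgZr_tmp; apply: cvgMr_tmp; exact: resid_weak_continuous.
by apply/funext => s; rewrite opprB addrA addrAC.
Qed.

End resid.

(** A weakly continuous curve takes its values in the closed span of its values
    at rational times, so its projections onto the spans of finitely many of
    these converge to it. *)
Lemma weakly_continuous_approx (R : realType) (H : hilbertType R) (g : R -> H) :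
  (forall w, continuous (fun s => inner (g s) w : R)) ->
  exists G : nat -> R -> H, [/\ forall n, continuous (G n),
    forall n s, `|G n s| <= `|g s| & forall s, G ^~ s @ \oo --> g s].
Proof.
move=> cg.
(* Every rational is met by the enumeration; the codes of no rational give 0. *)
pose a n := g (ratr (odflt 0 (choice.unpickle n : option rat))).
exists (fun n s => g s - resid a n (g s)); split => [n|n s|s].
- exact: resid_continuous.
- rewrite -(ler_pXn2r (n := 2)) ?nnegrE//.
  by rewrite (@resid_pythagoras _ _ a 0 n)//= lerBlDr lerDl sqr_ge0.
- rewrite -[X in _ --> X]subr0; apply: cvgB; [exact: cvg_cst|].
  apply: resid_cvg0 => w wa.
  apply: contrapT => /eqP h0.
  pose O := (fun t => inner (g t) w : R) @^-1` [set x | x != 0].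
  have oO : open O.
    by apply: open_comp; [move=> ? _; exact: cg|exact: open_neq].
  have O0 : O !=set0 by exists s; rewrite /O /= innerC.
  have [x [Ot [r _ rt]]] := @dense_rat R O O0 oO.
  move: Ot; rewrite /O /= -rt innerC => /eqP; apply.
  by rewrite -(wa (choice.pickle r)) /a choice.pickleK.
Qed.

(** * The Bochner integral *)

Section simple.
Context {R : realType} {d : measure_display} {T : measurableType d}.
Variables (mu : {measure set T -> \bar R}) (D : set T).
Hypotheses (mD : measurable D) (finD : (mu D < +oo)%E).

(** Simple functions with values in a bare type: pairs of simple functions, and
    their images under arbitrary functions, are then within reach. *)
Definition finvalued (X : Type) (s : T -> X) :=
  finite_set (range s) /\ forall y, measurable (D `&` s @^-1` [set y]).

Lemma finvalued_pair (X Y : Type) (s : T -> X) (r : T -> Y) :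
  finvalued s -> finvalued r -> finvalued (fun x => (s x, r x)).
Proof.
move=> [fs ms] [fr mr]; split.
  apply: (sub_finite_set _ (finite_setX fs fr)) => _ [x _ <-].
  by split; exists x.
move=> [a b].
rewrite (_ : _ `&` _ = (D `&` s @^-1` [set a]) `&` (D `&` r @^-1` [set b])).
  exact: measurableI.
apply/seteqP; split => [x [Dx [<- <-]]//|x [[Dx sa] [_ rb]]].
by split => //=; rewrite sa rb.
Qed.

Lemma finvalued_measurable (X : Type) (s : T -> X) (phi : X -> R) :
  finvalued s -> measurable_fun D (phi \o s).
Proof.
move=> [fs ms] _ Y mY.
rewrite (_ : _ `&` _ = \bigcup_(c in range s `&` phi @^-1` Y) (D `&` s @^-1` [set c])).
  by apply: fin_bigcup_measurable => //; exact: finite_setIl.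
apply/seteqP; split => [x [Dx Yx]|x [c [_ Yc] [Dx sc]]].
  by exists (s x) => //; split => //; exists x.
by split => //=; rewrite sc.
Qed.

Lemma bounded_integrable (f : T -> R) (K : R) :
  measurable_fun D f -> (forall x, D x -> `|f x| <= K) ->
  mu.-integrable D (EFin \o f).
Proof.
move=> mf fK; apply: measurable_bounded_integrable => //.
exists K; split; first exact: num_real.
by move=> M KM x Dx; exact: le_trans (fK x Dx) (ltW KM).
Qed.

Lemma finvalued_integrable (X : Type) (s : T -> X) (phi : X -> R) :
  finvalued s -> mu.-integrable D (EFin \o (phi \o s)).
Proof.
move=> fs.
pose A : set R := [set `|phi (s x)| | x in [set: T]].
have fA : finite_set A.
  rewrite (_ : A = (fun c => `|phi c|) @` range s).
    exact: finite_image fs.1.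
  by rewrite /A image_comp.
apply: (@bounded_integrable (phi \o s) (\sum_(r <- fset_set A) `|r|)).
  exact: finvalued_measurable.
move=> x _.
have xA : `|phi (s x)| \in fset_set A.
  by rewrite in_fset_set//; apply: mem_set; exists x.
by rewrite (big_rem _ xA)/= normr_id lerDl sumr_ge0.
Qed.

Lemma Rintegral_sum (I : Type) (L : seq I) (f : I -> T -> R) :
  (forall i, mu.-integrable D (EFin \o f i)) ->
  \int[mu]_(x in D) (\sum_(i <- L) f i x) =
  \sum_(i <- L) \int[mu]_(x in D) f i x.
Proof.
move=> intf; elim: L => [|i L IH].
  rewrite big_nil (_ : (fun x => _) = fun=> 0).
    by rewrite Rintegral_cst// mul0r.
  by apply/funext => x; rewrite big_nil.
rewrite big_cons -IH -RintegralD//.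
  by apply: eq_Rintegral => x _; rewrite big_cons.
have := @integrable_sum _ _ _ mu D mD _ L xpredT (fun i => EFin \o f i)
  (fun i _ => intf i).
by apply: eq_integrable => // x _ /=; rewrite sumEFin.
Qed.

Lemma finvalued_Rintegral (X : choiceType) (s : T -> X) (phi : X -> R) :
  finvalued s ->
  \int[mu]_(x in D) phi (s x) =
  \sum_(c \in range s) fine (mu (D `&` s @^-1` [set c])) * phi c.
Proof.
move=> fs; rewrite fsbig_finite/=; last exact: fs.1.
pose A c := D `&` s @^-1` [set c].
have i1 c : mu.-integrable D (EFin \o (\1_(A c) : T -> R)).
  apply: (@bounded_integrable _ 1).
    exact/measurable_indic/fs.2.
  by move=> x _; rewrite indicE; case: (_ \in _); rewrite ?normr1 ?normr0.
transitivity (\int[mu]_(x in D) \sum_(c <- fset_set (range s)) phi c * \1_(A c) x).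
  apply: eq_Rintegral => x /set_mem Dx.
  have xs : s x \in fset_set (range s).
    by rewrite in_fset_set; [apply: mem_set; exists x|exact: fs.1].
  rewrite (bigD1_seq _ xs)/=; last exact: fset_uniq.
  rewrite indicE mem_set//= mulr1 big1 ?addr0// => c cs.
  rewrite indicE memNset ?mulr0// => -[_ /= sc].
  by rewrite sc eqxx in cs.
rewrite Rintegral_sum.
  apply: eq_bigr => c _; rewrite RintegralZl// mulrC; congr (_ * _).
  rewrite /Rintegral integral_indic//; last exact: fs.2.
  by rewrite /A -setIA (setIC _ D) setIA setIid.
move=> c; rewrite (_ : _ \o _ = fun x => ((phi c)%:E * (\1_(A c) x)%:E)%E).
  exact: (@integrableZl _ _ _ mu D mD (phi c) _ (i1 c)).
by apply/funext.
Qed.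

End simple.

Section bochner_facts.
Context {R : realType} {E : completeNormedModType R} {d : measure_display}
        {T : measurableType d}.
Variables (mu : {measure set T -> \bar R}) (D : set T).
Hypotheses (mD : measurable D) (finD : (mu D < +oo)%E).

Lemma simple_finvalued (s : T -> E) : simple mu D s -> finvalued D s.
Proof. by move=> [fs ms]; split=> // y; have [] := ms y. Qed.

Lemma finvalued_simple (s : T -> E) : finvalued D s -> simple mu D s.
Proof.
move=> [fs ms]; split=> // y; split => // _.
apply: (le_lt_trans _ finD); apply: le_measure.
- exact/mem_set/ms.
- exact/mem_set.
- exact: subIsetl.
Qed.

Lemma dual_simple_integral (s : T -> E) (y : dual E) : finvalued D s ->
  y (simple_integral mu D s) = \int[mu]_(x in D) y (s x).
Proof.
move=> fs; rewrite (@finvalued_Rintegral _ _ _ mu D mD finD _ s y)//.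
rewrite /simple_integral fsbig_finite/=; last exact: fs.1.
rewrite fsbig_finite/=; last exact: fs.1.
rewrite linear_sum; apply: eq_bigr => c _.
by rewrite linearZ.
Qed.

(** Tested against a norming functional, the difference of two vector integrals
    becomes a difference of scalar ones; this avoids a common refinement of the
    two partitions. *)
Lemma norm_simple_integralB (s r : T -> E) : finvalued D s -> finvalued D r ->
  `|simple_integral mu D s - simple_integral mu D r| <=
  \int[mu]_(x in D) `|s x - r x|.
Proof.
move=> fs fr.
have [y [<- ynorm]] := hahn_banach (simple_integral mu D s - simple_integral mu D r).
have fsr := finvalued_pair fs fr.
rewrite linearB !dual_simple_integral// -RintegralB//; last 2 first.
- exact: finvalued_integrable (y : E -> R) fs.
- exact: finvalued_integrable (y : E -> R) fr.
apply: le_Rintegral => //.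
- exact: (@finvalued_integrable _ _ _ mu D mD finD _ _ (fun c => y c.1 - y c.2) fsr).
- exact: (@finvalued_integrable _ _ _ mu D mD finD _ _ (fun c => `|c.1 - c.2|) fsr).
by move=> x _; rewrite -linearB (le_trans (ler_norm _)).
Qed.

Section limit.
Variables (f : T -> E) (s : nat -> T -> E).
Hypotheses (fs : forall n, finvalued D (s n)).
Hypothesis sf : forall x, D x -> s n x @[n --> \oo] --> f x.

Lemma measurable_dist_simple n : measurable_fun D (fun x => `|f x - s n x|).
Proof.
apply: (@measurable_fun_cvg _ _ _ D (fun m x => `|s m x - s n x|)) => [m|x Dx].
  exact: (@finvalued_measurable R _ _ D _ (fun x => (s m x, s n x))
    (fun c => `|c.1 - c.2|) (finvalued_pair (fs m) (fs n))).
apply: cvg_norm; apply: cvgB; [exact: sf|exact: cvg_cst].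
Qed.

Lemma measurable_dual_limit (y : dual E) : measurable_fun D (fun x => y (f x) : R).
Proof.
apply: (@measurable_fun_cvg _ _ _ D (fun m x => y (s m x))) => [m|x Dx].
  exact: (@finvalued_measurable R _ _ D _ (s m) (y : E -> R) (fs m)).
apply: (@continuous_cvg _ _ _ _ _ _ y); [exact: bop_continuous|exact: sf].
Qed.

End limit.

(** The identity holds for simple functions, and passing to the limit costs at
    most the norm of y times the integrals that tend to 0 in [is_bochner]. *)
Lemma bochner_dual (f : T -> E) (v : E) (y : dual E) : is_bochner mu D f v ->
  mu.-integrable D (EFin \o (fun x => y (f x) : R)) /\
  y v = \int[mu]_(x in D) y (f x).
Proof.
move=> [s [ss sf If Iv]].
have fs n : finvalued D (s n) := simple_finvalued (ss n).
have [C [C0 yC]] := bop_bound y.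
pose g n x := `|f x - s n x|.
have mg n : measurable_fun D (g n) := measurable_dist_simple fs sf n.
have my : measurable_fun D (fun x => y (f x) : R) := measurable_dual_limit fs sf y.
have [Ifin fineI] := (fine_cvgP _ _).1 If.
have ig : \forall n \near \oo, mu.-integrable D (EFin \o g n).
  apply: filterS Ifin => n In; apply/integrableP; split.
    exact/measurable_EFinP.
  under eq_integral do rewrite /= normr_id.
  by rewrite ltey_eq In.
have iys n : mu.-integrable D (EFin \o (fun x => y (s n x) : R)).
  exact: finvalued_integrable (y : E -> R) (fs n).
have iCg : \forall n \near \oo, mu.-integrable D (EFin \o (fun x => C * g n x)).
  apply: filterS ig => n ign.
  by have := integrableZl mD C ign.
have idiff : \forall n \near \oo,
    mu.-integrable D (EFin \o (fun x => y (f x) - y (s n x) : R)).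
  apply: filterS iCg => n; apply: le_integrable => //.
    apply/measurable_EFinP/measurable_funB => //.
    by have := iys n => /measurable_int/measurable_EFinP.
  move=> x _ /=; rewrite lee_fin -linearB (le_trans (yC _))//.
  by rewrite ler_norm.
have iy : mu.-integrable D (EFin \o (fun x => y (f x) : R)).
  have [n _ /(_ n (leqnn n))/= idn] := idiff.
  have := integrableD mD idn (iys n).
  by apply: eq_integrable => // x _ /=; rewrite -EFinD subrK.
split=> //.
have yI : y (simple_integral mu D (s n)) @[n --> \oo] --> y v.
  apply: (@continuous_cvg _ _ _ _ _ _ y _ _ Iv); exact: bop_continuous.
apply: (cvg_unique (@Rhausdorff R) yI).
apply: (@cvg_dist_squeeze _ _ _ _ _ _ _
  (fun n => C * fine (\int[mu]_(x in D) (g n x)%:E)%E)).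
  near=> n; rewrite dual_simple_integral// -RintegralB//.
  have idn : mu.-integrable D (EFin \o (fun x => y (f x) - y (s n x) : R)).
    by near: n.
  have ign : mu.-integrable D (EFin \o g n) by near: n.
  rewrite -[_ * fine _](RintegralZl C mD ign).
  apply: le_trans (le_normr_Rintegral mD idn) _; apply: le_Rintegral => //.
  - exact: (integrable_abse idn).
  - by near: n.
  - by move=> x _; rewrite -linearB.
rewrite -[X in _ --> X](mulr0 C); exact: cvgMl_tmp.
Unshelve. all: by end_near. Qed.

Lemma is_bochner_bounded_limit (f : T -> E) (s : nat -> T -> E) (K : R) :
  (forall n, finvalued D (s n)) ->
  (forall x, D x -> s n x @[n --> \oo] --> f x) ->
  (forall n x, D x -> `|s n x| <= K) ->
  exists v, is_bochner mu D f v.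
Proof.
move=> fs sf sK.
have fK x : D x -> `|f x| <= K.
  move=> Dx; have h : (fun n => `|s n x|) @ \oo --> `|f x|.
    by apply: cvg_norm; exact: sf.
  apply: (ler_cvg_to h (cvg_cst K)).
  by apply: nearW => n; exact: sK.
pose g n x := `|f x - s n x|.
have mg n : measurable_fun D (g n) := measurable_dist_simple fs sf n.
have gK n x : D x -> `|g n x| <= K + K.
  by move=> Dx; rewrite normr_id (le_trans (ler_normB _ _))// lerD ?fK ?sK.
have ig n : mu.-integrable D (EFin \o g n).
  by apply: bounded_integrable (gK n).
have If : (\int[mu]_(x in D) (g n x)%:E)%E @[n --> \oo] --> 0%E.
  have [|||||_ _ Ig] := @dominated_convergence _ _ _ mu D mD
    (fun n => EFin \o g n) (cst 0%E) (EFin \o cst (K + K)).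
  - by move=> n; exact/measurable_EFinP.
  - exact: measurable_cst.
  - apply: aeW => x Dx; apply: cvg_EFin; first exact: nearW.
    rewrite -[X in _ --> X](@normr0 _ E) -(subrr (f x)).
    apply: cvg_norm; apply: cvgB; [exact: cvg_cst|exact: sf].
  - apply: (@bounded_integrable _ _ _ mu D mD finD (cst (K + K)) `|K + K|) => //.
  - by apply: aeW => x n Dx; rewrite lee_fin gK.
  by move: Ig; rewrite integral0.
have [_ fineI] := (fine_cvgP _ _).1 If.
have cI : cvgn (fun n => simple_integral mu D (s n)).
  apply: cauchy_cvgn => e e0.
  have e2 : 0 < e / 2 by rewrite divr_gt0.
  have [N _ HN] := cvgr_lt 0 fineI _ e2.
  exists N => n Nn; apply: le_lt_trans (norm_simple_integralB (fs N) (fs n)) _.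
  rewrite (splitr e); apply: le_lt_trans (ltrD (HN _ (leqnn N)) (HN _ Nn)).
  rewrite /= -RintegralD//; apply: le_Rintegral => //.
  - exact: (@finvalued_integrable _ _ _ mu D mD finD _ _ (fun c => `|c.1 - c.2|)
      (finvalued_pair (fs N) (fs n))).
  - by have := integrableD mD (ig N) (ig n).
  - by move=> x _; rewrite /g (distrC (f x)) (le_trans _ (ler_normD _ _))// addrA subrK.
exists (limn (fun n => simple_integral mu D (s n))), s; split => //.
by move=> n; exact: finvalued_simple.
Qed.

End bochner_facts.

Section step.
Context {R : realType}.

Lemma heine_itv (E : normedModType R) (F : R -> E) (t e : R) : continuous F -> 0 < e ->
  exists2 del, 0 < del & forall x y, 0 <= x <= t -> `|x - y| < del ->
    `|F x - F y| <= e.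
Proof.
move=> cF e0.
have := @segment_compact R 0 t; move/compact_near_coveringP.
move=> /(_ R (0^'+) (fun del x => forall y, `|x - y| < del -> `|F x - F y| <= e) _).
case.
  move=> x _.
  have e2 : 0 < e / 2 by rewrite divr_gt0.
  have /cvgrPdist_lt/(_ _ e2)/nbhs_normP[eta /= eta0 Feta] := cF x.
  have eta2 : 0 < eta / 2 by rewrite divr_gt0.
  near=> z r => y zy.
  have xz : `|x - z| < eta / 2 by near: z; exact: cvgr_dist_lt.
  have reta : r < eta / 2 by near: r; exact: nbhs_right_lt.
  have Fxz : `|F x - F z| < e / 2.
    by apply: Feta; rewrite /ball_/= (lt_trans xz)// ltr_pdivrMr// ltr_pMr// ltr1n.
  have Fxy : `|F x - F y| < e / 2.
    apply: Feta; rewrite /ball_/= -(subrK z x) -addrA.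
    by rewrite (le_lt_trans (ler_normD _ _))// (splitr eta) ltrD// (lt_trans zy).
  rewrite -(subrK (F x) (F z)) -addrA (le_trans (ler_normD _ _))// (splitr e).
  by rewrite lerD ?ltW// distrC.
move=> r0 /= r0p H.
exists (r0 / 2); first by rewrite divr_gt0.
move=> x y xt xy.
have := H (r0 / 2); apply => //=.
- by rewrite sub0r normrN gtr0_norm ?divr_gt0// ltr_pdivrMr// ltr_pMr// ltr1n.
- by rewrite divr_gt0.
Unshelve. all: by end_near. Qed.

Lemma step_approx (E : normedModType R) (F : R -> E) (t e : R) :
  continuous F -> 0 < e ->
  exists s : R -> E, finvalued (`[0, t] : set (measurableTypeR R)) s /\
   forall x, 0 <= x <= t -> `|F x - s x| <= e.
Proof.
move=> cF e0; have [del del0 Fdel] := heine_itv t cF e0.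
(* On [k del, (k + 1) del[ the step function takes the value of F at k del. *)
pose idx x := Num.truncn (x / del).
pose s x := if (0 <= x <= t) then F ((idx x)%:R * del) else 0.
have tE x : 0 <= x -> (idx x)%:R * del <= x < (idx x).+1%:R * del.
  move=> x0; rewrite -ler_pdivlMr// -ltr_pdivrMr//.
  by apply: truncn_itv; rewrite divr_ge0// ltW.
exists s; split.
  split.
  - apply: (@sub_finite_set _ _
        ([set 0] `|` (fun k : nat => F (k%:R * del)) @` `I_(idx t).+1)).
      move=> _ [x _ <-]; rewrite /s; case: ifPn => [/andP[x0 xt]|_]; last by left.
      right; exists (idx x) => //=; rewrite ltnS.
      by apply: le_truncn; rewrite ler_pM2r// invr_gt0.
    by rewrite finite_setU; split => //; exact: finite_image.
  - move=> y.
    rewrite (_ : _ `&` _ = \bigcup_(k in [set k : nat | F (k%:R * del) = y])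
       (`[0, t] `&` `[k%:R * del, k.+1%:R * del[)).
      by apply: bigcup_measurable => k _; exact: measurableI.
    apply/seteqP; split => [x [/=]|x [k /= Fk] []].
      rewrite in_itv /= /s => xt; rewrite xt => Fy; exists (idx x) => //=; split.
        by rewrite in_itv.
      by rewrite in_itv/= tE//; case/andP: xt.
    rewrite /= !in_itv/= /s => xt xk; rewrite xt; split => //.
    case/andP: (xt) => x0 _; case/andP: xk => xk1 xk2.
    rewrite (_ : idx x = k)//; apply/eqP.
    rewrite truncn_eq; last by rewrite divr_ge0// ltW.
    by rewrite ler_pdivlMr// ltr_pdivrMr// xk1.
move=> x xt; rewrite /s xt; apply: Fdel => //.
have x0 : 0 <= x by case/andP: xt.
have /andP[h1 h2] := tE _ x0.
by rewrite ger0_norm ?subr_ge0// ltrBlDl (lt_le_trans h2)// -natr1 mulrDl mul1r.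
Qed.

End step.

(** By compactness the n-th curve is within 1/(n+1) of a step function on
    [0, t], and dominated convergence applies to these step functions. *)
Lemma bochner_continuous_limit (R : realType) (E : completeNormedModType R)
    (F : nat -> R -> E) (f : R -> E) (t K : R) :
  (forall n, continuous (F n)) ->
  (forall n x, 0 <= x <= t -> `|F n x| <= K) ->
  (forall x, 0 <= x <= t -> F ^~ x @ \oo --> f x) ->
  is_bochner (@lebesgue_measure R) `[0, t] f
    (bochner (@lebesgue_measure R) `[0, t] f).
Proof.
move=> cF FK Ff.
suff [v fv] : exists v, is_bochner (@lebesgue_measure R) `[0, t] f v.
  by apply: xgetPex; exists v.
have e0 n : 0 < n.+1%:R^-1 :> R by rewrite invr_gt0.
have /choice[s sP] := fun n => step_approx t (cF n) (e0 n).
have inI x : `[0, t]%classic x -> 0 <= x <= t by rewrite /= in_itv.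
have finI : (@lebesgue_measure R `[0%R, t]%classic < +oo)%E.
  by rewrite lebesgue_measure_itv /=; case: ifP => _; exact: ltry.
apply: (@is_bochner_bounded_limit R E _ _ (@lebesgue_measure R) `[0, t]
  (measurable_itv _) finI f s (K + 1)).
- by move=> n; have [] := sP n.
- move=> x /inI xt.
  apply: (@cvg_dist_squeeze _ _ _ _ _ _ _ (fun n => `|f x - F n x| + n.+1%:R^-1)).
    apply: nearW => n; rewrite (le_trans (ler_distD (F n x) _ _))// lerD2l.
    by have [_] := sP n; exact.
  rewrite -[X in _ --> X]addr0; apply: cvgD; last exact: cvg_harmonic.
  rewrite -[X in _ --> X](@normr0 _ E) -(subrr (f x)).
  by apply: cvg_norm; apply: cvgB; [exact: cvg_cst|exact: Ff].
- move=> n x /inI xt; have [_ /(_ x xt) sn] := sP n.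
  rewrite -(subrK (F n x) (s n x)) (le_trans (ler_normD _ _))// addrC lerD ?FK//.
  by rewrite distrC (le_trans sn)// invf_le1// ler1n.
Qed.

(** * Orbits of strongly continuous semigroups *)

Section semigroup.
Context {R : realType} {E : completeNormedModType R}.
Variable S : R -> bounded_op E E.
Hypothesis hS : C0_semigroup S.

Lemma semigroup0 v : S 0 v = v.
Proof. by have [] := hS. Qed.

Lemma semigroupD s t v : 0 <= s -> 0 <= t -> S (s + t) v = S s (S t v).
Proof. by move=> s0 t0; have [_ ->] := hS. Qed.

Lemma semigroup_cvg0 v e : 0 < e ->
  exists2 del, 0 < del & forall t, 0 <= t < del -> `|S t v - v| < e.
Proof.
move=> e0; have [_ _ Sv] := hS.
have /cvgrPdist_lt/(_ _ e0) := Sv v => -[del /= del0 H].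
exists del => // t /andP[]; rewrite le_eqVlt => /predU1P[<- _|t0 td].
  by rewrite semigroup0 subrr normr0.
by rewrite distrC; apply: H => //=; rewrite sub0r normrN gtr0_norm.
Qed.

(** Otherwise there are times t_n tending to 0 for which [S t_n] has norm at
    least n, although [S t_n v] converges to v for each v: this contradicts the
    uniform boundedness principle. *)
Lemma semigroup_bounded_near0 :
  exists del K, [/\ 0 < del, 0 <= K &
    forall t v, 0 <= t <= del -> `|S t v| <= K * `|v|].
Proof.
apply: contrapT => nb.
have /choice[p pP] : forall n : nat, exists p : R * E,
    0 <= p.1 <= n.+1%:R^-1 /\ n%:R * `|p.2| < `|S p.1 p.2|.
  move=> n; apply: contrapT => np; apply: nb.
  exists n.+1%:R^-1, n%:R; split => // t v tn.
  by rewrite leNgt; apply/negP => lt; apply: np; exists (t, v).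
pose F := [set (S (p n).1 : E -> E) | n in [set: nat]].
have [f Ff|v|M HM] := @Banach_Steinhauss R E E F _ _ 1.
- have [n _ <-] := Ff; split; last exact: linearP.
  by apply/bounded_funP/linear_bounded_continuous; exact: bop_continuous.
- have cv : (fun n => S (p n).1 v) @ \oo --> v.
    apply/cvgrPdist_lt => e /(semigroup_cvg0 v)[del del0 H].
    have : \forall n \near \oo, (n.+1%:R^-1 : R) < del.
      exact: (near_infty_natSinv_lt (PosNum del0)).
    apply: filterS => n nd; rewrite distrC; apply: H.
    by have [/andP[-> pn] _] := pP n; rewrite (le_lt_trans pn).
  have /cvg_seq_bounded[M [_ HM]] : cvgn (fun n => S (p n).1 v) by exact: cvgP cv.
  by exists (M + 1) => f [n _ <-]; apply: HM => //; rewrite ltrDl.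
have [n Mn] : exists n : nat, M < n%:R.
  by exists (Num.truncn M).+1; exact: truncnS_gt.
have [_ np] := pP n.
have pn0 : 0 < `|(p n).2|.
  rewrite lt0r normr_ge0 andbT; apply/eqP => p0.
  by move: np; rewrite p0 mulr0 (normr0_eq0 p0) linear0 normr0 ltxx.
have Fn : F (S (p n).1) by exists n.
have := HM _ Fn (`|(p n).2|^-1 *: (p n).2).
rewrite linearZ /= !normrZ normfV normr_id mulVf ?gt_eqF// => /(_ (lexx _)).
rewrite ler_pdivrMl// leNgt => /negP; apply.
by rewrite (le_lt_trans _ np)// mulrC ler_pM2r// ltW.
Qed.

Lemma semigroup_bounded T :
  exists K, 0 <= K /\ forall t v, 0 <= t <= T -> `|S t v| <= K * `|v|.
Proof.
have [del [K0 [del0 K00 HK]]] := semigroup_bounded_near0.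
pose K := Num.max 1 K0.
have K1 : 1 <= K by rewrite le_max lexx.
have K0K : K0 <= K by rewrite le_max lexx orbT.
have bound n t v : 0 <= t <= n%:R * del -> `|S t v| <= K ^+ n * `|v|.
  elim: n t v => [|n IH] t v /andP[t0 tn].
    have -> : t = 0 by apply/eqP; rewrite eq_le t0 andbT; move: tn; rewrite mul0r.
    by rewrite semigroup0 expr0 mul1r.
  have [td|td] := leP t del.
    apply: le_trans (HK _ _ _) _; first by rewrite t0.
    rewrite ler_wpM2r// exprS (le_trans K0K)// ler_peMr ?(le_trans _ K1)//.
    exact: exprn_ege1.
  rewrite -(subrK del t) addrC semigroupD ?(ltW del0) ?subr_ge0 ?(ltW td)//.
  apply: le_trans (HK _ _ _) _; first by rewrite lexx ltW.
  rewrite exprS -mulrA ler_pM//; apply: IH.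
  rewrite subr_ge0 (ltW td)/= lerBlDr (le_trans tn)//.
  by rewrite -natr1 mulrDl mul1r.
have [n Tn] : exists n : nat, T / del < n%:R.
  by exists (Num.truncn (T / del)).+1; exact: truncnS_gt.
exists (K ^+ n); split; first by rewrite exprn_ge0// (le_trans _ K1).
move=> t v /andP[t0 tT]; apply: bound; rewrite t0 (le_trans tT)//.
by rewrite -ler_pdivrMr// ltW.
Qed.

(** Precomposing an orbit with [clamp] makes it continuous on the whole line. *)
Definition clamp (s : R) : R := Num.max 0 s.

Lemma clamp_ge0 s : 0 <= clamp s.
Proof. by rewrite /clamp le_max lexx. Qed.

Lemma clamp_id s : 0 <= s -> clamp s = s.
Proof. by move=> s0; rewrite /clamp max_r. Qed.

Lemma clamp_le s : clamp s <= `|s|.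
Proof. by rewrite /clamp ge_max normr_ge0 ler_norm. Qed.

Lemma clamp_dist s t : `|clamp s - clamp t| <= `|s - t|.
Proof.
rewrite /clamp /Num.max; have := ler_norm (s - t); have := ler_norm (t - s).
rewrite (distrC t s); case: ltP => s0; case: ltP => t0 h1 h2;
  rewrite ?subrr ?normr0 ?normr_ge0// ler_norml; lra.
Qed.

(** Continuity from the left is where local boundedness enters: [S a v - S b v]
    is the image under [S a] of [v - S (b - a) v]. *)
Lemma orbit_continuous v : continuous (fun s => S (clamp s) v).
Proof.
move=> s; apply/cvgrPdist_lt => e e0.
have [K [K0 HK]] := semigroup_bounded (`|s| + 1).
have e1 : 0 < e / (K + 1) by rewrite divr_gt0// ltr_wpDl.
have [del del0 H] := semigroup_cvg0 v e1.
have key a b : 0 <= a -> a <= b -> b <= `|s| + 1 -> b - a < del ->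
    `|S a v - S b v| < e.
  move=> a0 ab bs ba.
  have -> : S b v = S a (S (b - a) v).
    by rewrite -semigroupD ?subr_ge0// addrC subrK.
  rewrite -linearB.
  have := H (b - a); rewrite subr_ge0 ab ba => /(_ isT) Hba.
  apply: le_lt_trans (HK _ _ _) _; first by rewrite a0 (le_trans ab).
  rewrite distrC; apply: (@le_lt_trans _ _ ((K + 1) * `|S (b - a) v - v|)).
    by rewrite ler_wpM2r// lerDl.
  by rewrite -ltr_pdivlMl ?ltr_wpDl// mulrC.
near=> t.
have ts : `|s - t| < Num.min 1 del.
  by near: t; apply: cvgr_dist_lt; rewrite ?lt_min ?ltr01.
have /andP[ts1 tsd] : (`|s - t| < 1) && (`|s - t| < del) by rewrite -lt_min.
have cd := clamp_dist s t.
have cs : clamp s <= `|s| + 1 by rewrite (le_trans (clamp_le _))// lerDl.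
have ct : clamp t <= `|s| + 1.
  have := clamp_le t; have := ler_normB s (s - t); rewrite opprB addrC subrK.
  by lra.
have [st|/ltW ts'] := leP (clamp s) (clamp t).
  apply: key => //; first exact: clamp_ge0.
  by apply: le_lt_trans tsd; rewrite (le_trans _ cd)// distrC ler_norm.
rewrite distrC; apply: key => //; first exact: clamp_ge0.
by apply: le_lt_trans tsd; rewrite (le_trans _ cd)// ler_norm.
Unshelve. all: by end_near. Qed.

Lemma orbit_continuous2 (G : R -> E) : continuous G ->
  continuous (fun s => S (clamp s) (G s)).
Proof.
move=> cG s.
have [K [K0 HK]] := semigroup_bounded (`|s| + 1).
apply: (@cvg_dist_squeeze _ _ _ _ _ _ _
  (fun t => `|S (clamp s) (G s) - S (clamp t) (G s)| + K * `|G s - G t|)).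
  near=> t.
  rewrite (le_trans (ler_distD (S (clamp t) (G s)) _ _))// lerD2l.
  rewrite -linearB; apply: HK; rewrite clamp_ge0/= (le_trans (clamp_le t))//.
  have : `|s - t| < 1 by near: t; apply: cvgr_dist_lt.
  by have := ler_normB s (s - t); rewrite opprB addrC subrK; lra.
rewrite -[X in _ --> X]addr0; apply: cvgD.
  rewrite -[X in _ --> X](@normr0 _ E) -(subrr (S (clamp s) (G s))).
  by apply: cvg_norm; apply: cvgB; [exact: cvg_cst|exact: orbit_continuous].
rewrite -[X in _ --> X](mulr0 K); apply: cvgMl_tmp.
rewrite -[X in _ --> X](@normr0 _ E) -(subrr (G s)).
by apply: cvg_norm; apply: cvgB; [exact: cvg_cst|exact: cG].
Unshelve. all: by end_near. Qed.

End semigroup.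

(** * Integrals over translated intervals *)

Section translation.
Context {R : realType}.
Local Notation mu := (@lebesgue_measure R).

Lemma lebesgue_measure_shift (r : R) (A : set (measurableTypeR R)) : measurable A ->
  pushforward mu ((fun x => r + x) : _ -> measurableTypeR R) A = mu A.
Proof.
have mr : measurable_fun setT
    ((fun x => r + x) : measurableTypeR R -> measurableTypeR R).
  by apply: measurable_funD => //; exact: measurable_cst.
move=> mA; apply/esym/lebesgue_measure_unique => //= _ [[a b]] _ <-.
rewrite /pushforward (_ : _ @^-1` _ = `](a - r), (b - r)]%classic).
  rewrite !lebesgue_measure_itv/= !lte_fin ltrD2r.
  by case: ifP => // _; rewrite -!EFinB; congr EFin; lra.
by apply/seteqP; split => x /=; rewrite !in_itv/= ltrBlDl lerBrDl.
Qed.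

Lemma Rintegral_shift (f : R -> R) (r t : R) : measurable_fun `[r, r + t] f ->
  \int[mu]_(x in `[r, r + t]) f x = \int[mu]_(x in `[0, t]) f (r + x).
Proof.
move=> mf; rewrite /Rintegral; congr fine.
have mr : measurable_fun setT
    ((fun x => r + x) : measurableTypeR R -> measurableTypeR R).
  by apply: measurable_funD => //; exact: measurable_cst.
have shift0 (g : R -> \bar R) :
    measurable_fun `[r, r + t] g -> (forall x, 0 <= g x)%E ->
    (\int[mu]_(x in `[r, (r + t)%R]) g x =
     \int[mu]_(x in `[0%R, t]) (g \o +%R r) x)%E.
  move=> mg g0.
  rewrite (_ : `[0%R, t]%classic = (fun x => r + x)%R @^-1` `[r, (r + t)%R]%classic).
    rewrite -(ge0_integral_pushforward mr mu (D := `[r, r + t]) (f := g))//.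
    by apply: eq_measure_integral => //= A mA _; exact/esym/lebesgue_measure_shift.
  by apply/seteqP; split => x /=; rewrite !in_itv/= lerDl lerD2l.
have mf' : measurable_fun `[r, r + t] (EFin \o f) by exact/measurable_EFinP.
rewrite integralE [RHS]integralE; congr (_ - _)%E.
- rewrite (shift0 _ (measurable_funepos mf') (fun x => funepos_ge0 _ x)).
  by apply: eq_integral => x _; rewrite -funepos_comp.
- rewrite (shift0 _ (measurable_funeneg mf') (fun x => funeneg_ge0 _ x)).
  by apply: eq_integral => x _; rewrite -funeneg_comp.
Qed.

Lemma Rintegral_itv_add (f : R -> R) (r t : R) : 0 <= r -> 0 <= t ->
  mu.-integrable `[0, r + t] (EFin \o f) ->
  \int[mu]_(x in `[0, r + t]) f x =
  \int[mu]_(x in `[0, r]) f x + \int[mu]_(x in `[0, t]) f (r + x).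
Proof.
move=> r0 t0 fi.
apply/eqP; rewrite [X in _ == X]addrC -subr_eq; apply/eqP.
rewrite Rintegral_itvB//; last by rewrite bnd_simp lerDl.
have iD : mu.-integrable `]r, r + t] (EFin \o f).
  apply: (integrableS _ _ _ fi) => //.
  by move=> s /=; rewrite !in_itv/= => /andP[/ltW rs ->]; rewrite (le_trans r0 rs).
rewrite [LHS](Rintegral_itv_obnd_cbnd iD) Rintegral_shift//.
have := @measurable_int _ _ _ mu _ _ fi.
move=> /measurable_EFinP; apply: measurable_funS => //.
by move=> s /=; rewrite !in_itv/= => /andP[rs ->]; rewrite (le_trans r0 rs).
Qed.

Lemma Rintegral_itv_bounds (f : R -> R) (t m c : R) : 0 <= t ->
  mu.-integrable `[0, t] (EFin \o f) ->
  (forall s, 0 <= s <= t -> m <= f s <= c) ->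
  t * m <= \int[mu]_(s in `[0, t]) f s <= t * c.
Proof.
move=> t0 fi mc.
have mut : (@lebesgue_measure R `[0%R, t]%classic = t%:E)%E.
  rewrite lebesgue_measure_itv/= lte_fin -EFinB subr0.
  by case: ltP => // t0'; congr EFin; apply/eqP; rewrite eq_le t0 t0'.
have cst k : (\int[@lebesgue_measure R]_(s in `[0, t]) k : R) = t * k.
  rewrite Rintegral_cst; last exact: measurable_itv.
  by rewrite mulrC; congr (_ * k); exact: (congr1 fine mut).
have ci k : lebesgue_measure.-integrable `[0, t] (EFin \o (fun=> k : R)).
  apply: measurable_bounded_integrable => //.
  - by have := ltry t; rewrite -mut.
  - by exists `|k|; split; [exact: num_real|move=> ? ? ? _; exact: ltW].
rewrite -!cst; apply/andP; split; apply: le_Rintegral => // s;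
  by rewrite /= in_itv/= => /mc/andP[].
Qed.

End translation.

(** * The covariance operators *)

Section adjoint.
Context {R : realType} {E : normedModType R} {H : hilbertType R}.
Variable i : bounded_op H E.

Lemma hadjointE (x : dual E) h : inner (hadjoint i x) h = x (i h).
Proof.
have [C [C0 xC]] := bop_bound (bcomp x i).
have [|k [_ kx]] := @riesz_along R H H id (bcomp x i) 0 C _ xC (ltW C0).
- move=> a u v; exists (a *: u + v); split => //.
  exact: (linearP (bcomp x i)).
have : exists k : H, forall h, inner k h = x (i h) by exists k.
by move=> /(xgetPex 0); exact.
Qed.

Lemma hadjoint_lin (a : R) (x y z : dual E) :
  (forall v, z v = a *: x v + y v) ->
  hadjoint i z = a *: hadjoint i x + hadjoint i y.
Proof.
move=> zE; apply: inner_inj => h.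
by rewrite innerDl innerZl !hadjointE zE.
Qed.

Lemma hadjoint_bound : exists B, 0 <= B /\ forall (x : dual E) C, 0 <= C ->
  (forall v, `|x v| <= C * `|v|) -> `|hadjoint i x| <= B * C.
Proof.
have [B [B0 iB]] := bop_bound i; exists B; split; first exact: ltW.
move=> x C C0 xC; set k := hadjoint i x.
have [->|k0] := eqVneq k 0; first by rewrite normr0 mulr_ge0// ltW.
rewrite -(ler_pM2r (x := `|k|)) ?normr_gt0// -expr2 -inner_norm hadjointE.
rewrite (le_trans (ler_norm _))// (le_trans (xC _))// (mulrC B) -mulrA.
by rewrite ler_wpM2l.
Qed.

End adjoint.

Section covariance.
Context {R : realType} {E : completeNormedModType R} {H : hilbertType R}.
Variables (S : R -> bounded_op E E) (i : bounded_op H E).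
Hypothesis hS : C0_semigroup S.

Definition adj_orbit (x : dual E) (s : R) : H := hadjoint i (dual_op (S s) x).

Lemma inner_adj_orbit x s h : inner (adj_orbit x s) h = x (S s (i h)).
Proof. exact: hadjointE. Qed.

Lemma dual_Qop (x : dual E) : x (Qop i x) = `|hadjoint i x| ^+ 2.
Proof. by rewrite -inner_norm hadjointE. Qed.

Lemma adj_orbit_shift x r s : 0 <= r -> 0 <= s ->
  adj_orbit (dual_op (S r) x) s = adj_orbit x (r + s).
Proof.
move=> r0 s0; apply: inner_inj => h; rewrite !inner_adj_orbit.
by rewrite (semigroupD hS).
Qed.

Lemma adj_orbit_weak_continuous x w :
  continuous (fun s => inner (adj_orbit x (clamp s)) w : R).
Proof.
under eq_fun do rewrite inner_adj_orbit.
move=> s; apply: (@continuous_cvg _ _ _ _ _ (fun s => S (clamp s) (i w)) x).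
  exact: bop_continuous.
exact: orbit_continuous.
Qed.

Lemma adj_orbit_bounded x T :
  exists K, 0 <= K /\ forall s, 0 <= s <= T -> `|adj_orbit x s| <= K.
Proof.
have [B [B0 HB]] := hadjoint_bound i.
have [K [K0 HK]] := semigroup_bounded hS T.
have [C [C0 HC]] := bop_bound x.
exists (B * (C * K)); split; first by rewrite !mulr_ge0// ltW.
move=> s sT; apply: HB; first by rewrite mulr_ge0// ltW.
move=> v; rewrite (le_trans (HC _))// -mulrA ler_wpM2l ?HK//.
exact: ltW.
Qed.

(** The orbit [adj_orbit x] is weakly continuous and locally bounded; its
    continuous approximations, transported by the strongly continuous S, show
    that the integrand of Q_t is Bochner integrable. *)
Lemma Qt_dual (x : dual E) (t : R) :
  lebesgue_measure.-integrable `[0, t]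
    (EFin \o (fun s => `|adj_orbit x s| ^+ 2)) /\
  x (Qt S i t x) = \int[lebesgue_measure]_(s in `[0, t]) (`|adj_orbit x s| ^+ 2).
Proof.
have [G [cG Gle Gcvg]] := 
  weakly_continuous_approx (fun w => @adj_orbit_weak_continuous x w).
have [B [B0 HB]] := adj_orbit_bounded x t.
have [K [K0 HK]] := semigroup_bounded hS t.
have [C [C0 HC]] := bop_bound i.
pose f s := S s (Qop i (dual_op (S s) x)).
have isQ : is_bochner (@lebesgue_measure R) `[0, t] f (Qt S i t x).
  apply: (@bochner_continuous_limit _ _ (fun n s => S (clamp s) (i (G n s)))
    f t (K * (C * B))).
  - move=> n; apply: orbit_continuous2 => // s.
    by apply: (@continuous_cvg _ _ _ _ _ (G n) i); [exact: bop_continuous|exact: cG].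
  - move=> n s st; have s0 : 0 <= s by case/andP: st.
    rewrite clamp_id// (le_trans (HK _ _ st))// ler_wpM2l//.
    rewrite (le_trans (HC _))// (ler_wpM2l (ltW C0))//.
    by rewrite (le_trans (Gle _ _))// clamp_id// HB.
  - move=> s st; have s0 : 0 <= s by case/andP: st.
    rewrite clamp_id//.
    have := Gcvg s; rewrite clamp_id// => Gs.
    apply: (@continuous_cvg _ _ _ _ _ (fun n => i (G n s)) (S s)).
      exact: bop_continuous.
    by apply: (@continuous_cvg _ _ _ _ _ (G ^~ s) i); first exact: bop_continuous.
have finI : (@lebesgue_measure R `[0%R, t]%classic < +oo)%E.
  by rewrite lebesgue_measure_itv /=; case: ifP => _; exact: ltry.
have := @bochner_dual R E _ _ (@lebesgue_measure R) `[0, t] (measurable_itv _)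
  finI f _ x isQ.
rewrite (_ : (fun s => x (f s) : R) = fun s => `|adj_orbit x s| ^+ 2)//.
by apply/funext => s; rewrite -inner_norm inner_adj_orbit.
Qed.

Lemma Qt_dual_bounds (x : dual E) (t m c : R) : 0 <= t ->
  (forall s, 0 <= s <= t -> m <= `|adj_orbit x s| ^+ 2 <= c) ->
  t * m <= x (Qt S i t x) <= t * c.
Proof.
by move=> t0 mc; have [ixt ->] := Qt_dual x t; exact: Rintegral_itv_bounds.
Qed.

Lemma Qt_dual_add (x : dual E) (r t : R) : 0 <= r -> 0 <= t ->
  x (Qt S i (r + t) x) = x (Qt S i r x) +
    dual_op (S r) x (Qt S i t (dual_op (S r) x)).
Proof.
move=> r0 t0.
have [irt ->] := Qt_dual x (r + t); have [_ ->] := Qt_dual x r.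
have [_ ->] := Qt_dual (dual_op (S r) x) t.
rewrite (Rintegral_itv_add r0 t0 irt); congr (_ + _).
apply: eq_Rintegral => s /set_mem; rewrite /= in_itv/= => /andP[s0 _].
by rewrite adj_orbit_shift.
Qed.

End covariance.

(** * Functionals with Lipschitz orbits *)

Section mollify.
Context {R : realType} {E : completeNormedModType R}.
Variable S : R -> bounded_op E E.
Hypothesis hS : C0_semigroup S.
Local Notation mu := (@lebesgue_measure R).

(** The functionals whose orbit under the adjoint semigroup is Lipschitz in norm
    near 0; those in the domain of the adjoint generator are of this kind. *)
Definition regular (y : dual E) :=
  exists2 L, 0 <= L & forall r v, 0 <= r <= 1 ->
    `|y (S r v) - y v| <= L * r * `|v|.

Lemma regular_lin (a : R) (x y z : dual E) : regular x -> regular y ->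
  (forall v, z v = a *: x v + y v) -> regular z.
Proof.
move=> [L L0 xL] [L' L'0 yL] zE.
exists (`|a| * L + L'); first by rewrite addr_ge0 ?mulr_ge0.
move=> r v r01; rewrite !zE opprD addrACA -scalerBr !mulrDl -!mulrA.
rewrite (le_trans (ler_normD _ _))// lerD ?mulrA ?yL//.
by rewrite -!mulrA normrZ ler_wpM2l// mulrA xL.
Qed.

Variable x : dual E.
Let phi v s : R := x (S (clamp s) v).

Let phi_continuous v : continuous (phi v).
Proof.
move=> s; apply: (@continuous_cvg _ _ _ _ _ (fun s => S (clamp s) v) x).
  exact: bop_continuous.
exact: orbit_continuous.
Qed.

Let phi_bounded T :
  exists K, 0 <= K /\ forall s v, 0 <= s <= T -> `|phi v s| <= K * `|v|.
Proof.
have [K [K0 HK]] := semigroup_bounded hS T.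
have [C [C0 HC]] := bop_bound x.
exists (C * K); split; first by rewrite mulr_ge0// ltW.
move=> s v sT; rewrite /phi clamp_id; last by case/andP: sT.
by rewrite (le_trans (HC _))// -mulrA ler_wpM2l ?HK// ltW.
Qed.

Let phi_integrable v T : mu.-integrable `[0, T] (EFin \o phi v).
Proof.
apply: continuous_compact_integrable; first exact: segment_compact.
exact: continuous_subspaceT.
Qed.

Let phi_shift_integrable v r T :
  mu.-integrable `[0, T] (EFin \o (fun s => phi v (r + s))).
Proof.
apply: continuous_compact_integrable; first exact: segment_compact.
apply: continuous_subspaceT => s.
apply: (@continuous_comp _ _ _ (fun s => r + s) (phi v)); last exact: phi_continuous.
by apply: cvgD; [exact: cvg_cst|exact: cvg_id].
Qed.

(** Shifting the interval [0, h] by r changes the average by integrals over two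
    intervals of length r, which yields the Lipschitz bound. *)
Lemma mollify (h : R) : 0 < h ->
  exists2 y : dual E, regular y &
    forall v, y v = h^-1 * \int[mu]_(s in `[0, h]) phi v s.
Proof.
move=> h0.
have [K [K0 HK]] := phi_bounded (h + 1).
pose I v := \int[mu]_(s in `[0, h]) phi v s.
have lI : linear (fun v => (h^-1 * I v : R^o)).
  move=> a u v; rewrite /I.
  have -> : (\int[mu]_(s in `[0, h]) phi (a *: u + v) s : R) =
      \int[mu]_(s in `[0, h]) (a * phi u s + phi v s).
    by apply: eq_Rintegral => s _; rewrite /phi (linearP (S (clamp s))) linearP.
  rewrite RintegralD//; last first.
    exact: (@integrableZl _ _ R mu `[0%R, h]%classic (measurable_itv _) a _
      (phi_integrable u h)).
  by rewrite RintegralZl// mulrDr mulrCA.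
have IK v : `|h^-1 * I v| <= K * `|v|.
  have := @Rintegral_itv_bounds _ (phi v) h (- (K * `|v|)) (K * `|v|)
    (ltW h0) (phi_integrable v h).
  rewrite -/(I v) mulrN -ler_norml => ih.
  rewrite normrM gtr0_norm ?invr_gt0// ler_pdivrMl// ih// => s /andP[s0 sh].
  by rewrite -ler_norml HK// s0 (le_trans sh)// lerDl.
have [y yE] := @bop_build _ _ R^o _ K lI IK.
exists y => //.
exists (h^-1 * (2 * K)); first by rewrite !mulr_ge0 ?invr_ge0// ltW.
move=> r v /andP[r0 r1]; rewrite !yE -mulrBr normrM gtr0_norm ?invr_gt0// -!mulrA.
rewrite ler_pM2l ?invr_gt0//.
have -> : I (S r v) = \int[mu]_(s in `[0, h]) phi v (r + s).
  apply: eq_Rintegral => s /set_mem; rewrite /= in_itv/= => /andP[s0 _].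
  by rewrite /phi !clamp_id ?addr_ge0// addrC (semigroupD hS).
have e1 := Rintegral_itv_add r0 (ltW h0) (phi_integrable v (r + h)).
have e2 := Rintegral_itv_add (ltW h0) r0 (phi_integrable v (h + r)).
rewrite (addrC h r) in e2.
have b1 := @Rintegral_itv_bounds _ (phi v) r (- (K * `|v|)) (K * `|v|) r0
  (phi_integrable v r).
have b2 := @Rintegral_itv_bounds _ (fun s => phi v (h + s)) r
  (- (K * `|v|)) (K * `|v|) r0 (phi_shift_integrable v h r).
have {}b1 : `|\int[mu]_(s in `[0, r]) phi v s| <= r * (K * `|v|).
  rewrite ler_norml -mulrN b1// => s /andP[s0 sr].
  by rewrite -ler_norml HK// s0 (le_trans sr)// (le_trans r1)// lerDr ltW.
have {}b2 : `|\int[mu]_(s in `[0, r]) phi v (h + s)| <= r * (K * `|v|).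
  rewrite ler_norml -mulrN b2// => s /andP[s0 sr].
  by rewrite -ler_norml HK// addr_ge0 ?(ltW h0)//= lerD2l (le_trans sr).
rewrite -/(I v) in e2.
have -> : \int[mu]_(s in `[0, h]) phi v (r + s) - I v =
   \int[mu]_(s in `[0, r]) phi v (h + s) - \int[mu]_(s in `[0, r]) phi v s.
  by move: e1 e2; set a := Rintegral _ _ _; lra.
rewrite (le_trans (ler_normB _ _))// (le_trans (lerD b2 b1))//.
by rewrite le_eqVlt; apply/orP; left; apply/eqP; ring.
Qed.

Lemma regular_dense (v : E) (e : R) : 0 < e ->
  exists2 y : dual E, regular y & `|y v - x v| <= e.
Proof.
move=> e0.
have /cvgrPdist_le/(_ _ e0)/nbhs_normP[h /= h0 Hh] := @phi_continuous v 0.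
have h20 : 0 < h / 2 by rewrite divr_gt0.
have [y ry yE] := mollify h20.
exists y => //; rewrite yE.
have phi0 : phi v 0 = x v by rewrite /phi clamp_id// (semigroup0 hS).
have := @Rintegral_itv_bounds _ (phi v) (h / 2) (x v - e) (x v + e)
  (ltW h20) (phi_integrable v _).
case/(_ _)/andP.
  move=> s /andP[s0 sh]; rewrite -ler_distl -phi0 distrC; apply: Hh.
  rewrite /ball_/= sub0r normrN ger0_norm// (le_lt_trans sh)//.
  by rewrite ltr_pdivrMr// ltr_pMr// ltr1n.
move=> h1 h2; rewrite ler_distl; apply/andP; split.
  by rewrite -(ler_pM2l h20) mulVKf ?gt_eqF.
by rewrite -(ler_pM2l h20) mulVKf ?gt_eqF.
Qed.

End mollify.

(** * Reproducing kernel Hilbert spaces *)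

Section rkhs.
Context {R : realType} {E : completeNormedModType R} {K : hilbertType R}.
Variables (Rop : dual E -> E) (iK : bounded_op K E).
Hypothesis rk : is_rkhs Rop iK.

Lemma rkhs_eq0 (J : E -> K) (f : K -> R) : dense (range (J \o Rop)) ->
  continuous f -> (forall x, f (J (Rop x)) = 0) -> forall w, f w = 0.
Proof.
move=> dJ cf f0 w; apply: contrapT => /eqP fw.
pose O := f @^-1` [set r | r != 0].
have oO : open O by apply: open_comp; [move=> ? _; exact: cf|exact: open_neq].
have O0 : O !=set0 by exists w.
have [u [Ou [x _ xu]]] := dJ O O0 oO.
by move: Ou; rewrite /O /= -xu /= f0 eqxx.
Qed.

(** Both sides have the same inner product with every vector [J (Rop y)], by
    symmetry of the inner product, and these vectors are dense. *)
Lemma rkhs_adjoint (J : E -> K) (x : dual E) :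
  (forall x y : dual E, inner (J (Rop x)) (J (Rop y)) = y (Rop x)) ->
  dense (range (J \o Rop)) -> (forall x, iK (J (Rop x)) = Rop x) ->
  J (Rop x) = hadjoint iK x.
Proof.
move=> Ji dJ iJ; apply: inner_inj => w; rewrite hadjointE; apply/subr0_eq.
apply: (@rkhs_eq0 J (fun w => inner (J (Rop x)) w - (x (iK w) : R)) dJ).
  move=> u; apply: cvgB; first exact: continuous_innerr.
  apply: (@continuous_cvg _ _ _ _ _ iK x); exact: bop_continuous.
by move=> y; rewrite innerC Ji iJ subrr.
Qed.

Lemma rkhs_factor (x : dual E) : Rop x = Qop iK x.
Proof.
by have [J [Ji dJ iJ]] := rk; rewrite /Qop -(rkhs_adjoint x Ji dJ iJ) iJ.
Qed.

Lemma rkhs_inj : injective iK.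
Proof.
move=> u v uv; apply/subr0_eq/inner_eq0.
have [J [Ji dJ iJ]] := rk.
apply: (@rkhs_eq0 J (fun w => inner w (u - v)) dJ) => [w|x].
  exact: continuous_innerl.
by rewrite (rkhs_adjoint x Ji dJ iJ) hadjointE linearB uv subrr linear0.
Qed.

End rkhs.

(** * The equivalence *)

Lemma expR_le_compound (R : realType) (w : R) : 0 <= w ->
  expR (w / (1 + w)) <= 1 + w.
Proof.
move=> w0; have w1 : 0 < 1 + w by rewrite ltr_wpDr.
have := expR_ge1Dx (- (w / (1 + w))).
rewrite expRN (_ : 1 - w / (1 + w) = (1 + w)^-1).
  by rewrite lef_pV2// posrE expR_gt0.
apply: (mulIf (lt0r_neq0 w1)).
by rewrite mulrBl divfK ?gt_eqF// mulVf ?gt_eqF// mul1r addrK.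
Qed.

(** The bound [expR (w / (1 + w)) <= 1 + w] at w / n turns the n-fold product into
    an exponential whose argument tends to w. *)
Lemma mul_expR_le (R : realType) (a b w : R) : 0 <= a -> 0 <= w ->
  (forall n, a * (1 + w / n.+1%:R) ^+ n.+1 <= b) -> a * expR w <= b.
Proof.
move=> a0 w0 h.
have u0 n : 0 <= w / n.+1%:R by rewrite divr_ge0.
(* [e n] is n.+1 times v / (1 + v) for v = w / n.+1. *)
pose e n := w / (1 + w / n.+1%:R).
have ew : e @ \oo --> w.
  rewrite -[X in _ --> X](@divr1 R) -[X in _ --> w / X](addr0 1).
  apply: cvgMl_tmp; apply: cvgV; first by rewrite addr0 oner_eq0.
  apply: cvgD; first exact: cvg_cst.
  by rewrite -[X in _ --> X](mulr0 w); apply: cvgMl_tmp; exact: cvg_harmonic.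
have aew : (fun n => a * expR (e n)) @ \oo --> a * expR w.
  apply: cvgMl_tmp; apply: (@continuous_cvg _ _ _ _ _ e (@expR R)) => //.
  exact: continuous_expR.
apply: (ler_cvg_to aew (cvg_cst b)); apply: nearW => n.
apply: le_trans (h n); rewrite ler_wpM2l//.
have -> : e n = n.+1%:R * ((w / n.+1%:R) / (1 + w / n.+1%:R)).
  by rewrite mulrA mulrCA divff ?mulr1// pnatr_eq0.
by rewrite expRM_natl ler_pXn2r ?nnegrE ?expR_ge0 ?addr_ge0 ?expR_le_compound.
Qed.

Section equivalence.
Context {R : realType} {E : completeNormedModType R}.
Variable S : R -> bounded_op E E.
Hypothesis hS : C0_semigroup S.
Context {H : hilbertType R}.
Variable i : bounded_op H E.
Context {K : hilbertType R}.
Variable iK : bounded_op K E.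
Hypothesis iK_inj : injective iK.
Hypothesis Qt_cvg : forall x : dual E,
  x (Qt S i t x) @[t --> +oo] --> `|hadjoint iK x| ^+ 2.

(** The energy identity: [Q_(r + t)] is the sum of [Q_r] and of
    [S(r) Q_t S(r)^*]; let t tend to infinity. *)
Lemma adjoint_orbit_decay x r : 0 <= r ->
  `|hadjoint iK (dual_op (S r) x)| ^+ 2 = `|hadjoint iK x| ^+ 2 - x (Qt S i r x).
Proof.
move=> r0; apply/eqP; rewrite eq_sym subr_eq addrC; apply/eqP.
have h1 : x (Qt S i (t + r) x) @[t --> +oo] --> `|hadjoint iK x| ^+ 2.
  by rewrite (cvg_shiftr r (fun t => x (Qt S i t x) : R)); exact: Qt_cvg.
have h2 : x (Qt S i (t + r) x) @[t --> +oo] -->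
    x (Qt S i r x) + `|hadjoint iK (dual_op (S r) x)| ^+ 2.
  apply: (@cvg_trans _ ((fun t => x (Qt S i r x) +
     dual_op (S r) x (Qt S i t (dual_op (S r) x))) @ +oo)).
    apply: near_eq_cvg; near=> t; rewrite (addrC t) Qt_dual_add//.
  by apply: cvgD; [exact: cvg_cst|exact: Qt_cvg].
exact: (cvg_unique (@Rhausdorff R) h1 h2).
Unshelve. all: by end_near. Qed.

Lemma Qt_ge0 (x : dual E) r : 0 <= r -> 0 <= x (Qt S i r x).
Proof.
move=> r0; have [C [C0 HC]] := adj_orbit_bounded i hS x r.
have b s : 0 <= s <= r -> 0 <= `|adj_orbit S i x s| ^+ 2 <= C ^+ 2.
  by move=> sr; rewrite sqr_ge0/= ler_pXn2r ?nnegrE//; exact: HC.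
by have /andP[+ _] := Qt_dual_bounds hS r0 b; rewrite mulr0.
Qed.

Lemma adjoint_orbit_decay_le x r : 0 <= r ->
  `|hadjoint iK (dual_op (S r) x)| ^+ 2 <= `|hadjoint iK x| ^+ 2.
Proof. by move=> r0; rewrite adjoint_orbit_decay// lerBlDr lerDl Qt_ge0. Qed.

(** The vector w' represents [x |-> (iK^* S(t)^* x, w)] along [iK^*], so that
    [x (iK w') = x (S t (iK w))] for all x. *)
Lemma restriction_bound (c t : R) : 0 <= c ->
  (forall x, `|hadjoint iK (dual_op (S t) x)| <= c * `|hadjoint iK x|) ->
  forall w, exists w', `|w'| <= c * `|w| /\ iK w' = S t (iK w).
Proof.
move=> c0 xc w.
(* Any functional serves as a witness that the dual is inhabited. *)
have [x0 _] := hahn_banach (0 : E).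
have [||| h [hc hE]] := @riesz_along R K (dual E) (hadjoint iK)
  (fun x => inner (hadjoint iK (dual_op (S t) x)) w) x0 (c * `|w|).
- move=> a x y; have [z zE] := bop_lin x y a; exists z.
  rewrite (hadjoint_lin iK zE); split => //.
  rewrite (@hadjoint_lin _ _ _ iK a (dual_op (S t) x) (dual_op (S t) y)
    (dual_op (S t) z)) ?innerDl ?innerZl//.
  by move=> v; exact: zE.
- move=> x; rewrite (le_trans (cauchy_schwarz _ _))//.
  by rewrite mulrAC ler_wpM2r.
- by rewrite mulr_ge0.
exists h; split => //; apply: dual_separates => x.
by rewrite -(hadjointE iK) innerC hE (hadjointE iK).
Qed.

(** The energy identity bounds [|iK^* S(t)^* x|] by [|iK^* x|], so the range of iK
    is invariant and the restriction is not a default value. *)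
Lemma restrictionE t w : 0 <= t -> iK (restriction iK (S t) w) = S t (iK w).
Proof.
move=> t0.
have [x|w' [_ w'E]] := @restriction_bound 1 t ler01 _ w.
  rewrite mul1r -(ler_pXn2r (n := 2)) ?nnegrE//; exact: adjoint_orbit_decay_le.
have ex : exists k, iK k = S t (iK w) by exists w'.
exact: (xgetPex 0 ex).
Qed.

Lemma restrictionZ t a w : 0 <= t ->
  restriction iK (S t) (a *: w) = a *: restriction iK (S t) w.
Proof.
by move=> t0; apply: iK_inj; rewrite restrictionE// !linearZ/= restrictionE.
Qed.

(** The restriction of S(t) and the map sending [iK^* x] to [iK^* S(t)^* x] are
    adjoint to each other, hence have the same bounds. *)
Lemma opnorm_restriction (c t : R) : 0 <= c -> 0 <= t ->
  (opnorm (restriction iK (S t)) <= c%:E)%E <->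
  (forall x, `|hadjoint iK (dual_op (S t) x)| <= c * `|hadjoint iK x|).
Proof.
move=> c0 t0; split=> [opc x|xc].
  have opw w : `|restriction iK (S t) w| <= c * `|w|.
    have [->|w0] := eqVneq w 0.
      by have := @restrictionZ t 0 0 t0; rewrite !scale0r => ->; rewrite normr0 mulr0.
    have wp : 0 < `|w| by rewrite normr_gt0.
    have : (`|restriction iK (S t) (`|w|^-1 *: w)|%:E <= c%:E)%E.
      apply: le_trans opc; apply: ereal_sup_ubound.
      exists (`|w|^-1 *: w) => //=.
      by rewrite normrZ normfV normr_id mulVf ?gt_eqF.
    rewrite lee_fin restrictionZ// normrZ normfV normr_id ler_pdivrMl//.
    by rewrite mulrC.
  set w := hadjoint iK (dual_op (S t) x).
  have [->|w0] := eqVneq w 0; first by rewrite normr0 mulr_ge0.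
  rewrite -(ler_pM2r (x := `|w|)) ?normr_gt0// -expr2 -inner_norm.
  rewrite {1}/w (hadjointE iK) /= -restrictionE// -(hadjointE iK).
  rewrite (le_trans (ler_norm _))// (le_trans (cauchy_schwarz _ _))//.
  by rewrite (mulrC c) -mulrA ler_wpM2l.
apply: ge_ereal_sup => _ [w /= w1 <-]; rewrite lee_fin.
have [w' [w'c w'E]] := restriction_bound c0 xc w.
have -> : restriction iK (S t) w = w' by apply: iK_inj; rewrite restrictionE.
by rewrite (le_trans w'c)// ler_piMr.
Qed.

Variable M : R.
Hypothesis M0 : 0 < M.

Section domination.
Hypothesis dom : forall x : dual E, `|hadjoint iK x| ^+ 2 <= M * `|hadjoint i x| ^+ 2.

(** On [0, t] the integrand [|i^* S(s)^* x|^2] is at least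
    [|iK^* S(s)^* x|^2 / M], which is at least its value at s = t divided by M. *)
Lemma dominated_decay_step x t : 0 <= t ->
  `|hadjoint iK (dual_op (S t) x)| ^+ 2 * (1 + t / M) <= `|hadjoint iK x| ^+ 2.
Proof.
move=> t0; set a := `|hadjoint iK (dual_op (S t) x)| ^+ 2.
have [C [C0 HC]] := adj_orbit_bounded i hS x t.
have b s : 0 <= s <= t -> a / M <= `|adj_orbit S i x s| ^+ 2 <= C ^+ 2.
  move=> st; have /andP[s0 ts] := st.
  rewrite ler_pXn2r ?nnegrE ?HC// andbT ler_pdivrMr// mulrC.
  apply: le_trans (dom _).
  have -> : a = `|hadjoint iK (dual_op (S (t - s)) (dual_op (S s) x))| ^+ 2.
    rewrite /a; congr (`|hadjoint iK _| ^+ 2); apply: bop_ext => v /=.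
    by rewrite -(semigroupD hS) ?subr_ge0// addrC subrK.
  by apply: adjoint_orbit_decay_le; rewrite subr_ge0.
have /andP[h _] := Qt_dual_bounds hS t0 b.
have := adjoint_orbit_decay x t0; rewrite -/a => ea.
by rewrite mulrDr mulr1 mulrCA; lra.
Qed.

Lemma dominated_decay_iter n x u : 0 <= u ->
  `|hadjoint iK (dual_op (S (n%:R * u)) x)| ^+ 2 * (1 + u / M) ^+ n <=
    `|hadjoint iK x| ^+ 2.
Proof.
move=> u0; elim: n => [|n IH].
  rewrite expr0 mulr1 mul0r (_ : dual_op (S 0) x = x)//.
  by apply: bop_ext => v /=; rewrite (semigroup0 hS).
apply: le_trans IH.
have -> : dual_op (S (n.+1%:R * u)) x = dual_op (S u) (dual_op (S (n%:R * u)) x).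
  apply: bop_ext => v /=.
  by rewrite -(semigroupD hS) ?mulr_ge0// -natr1 mulrDl mul1r.
rewrite (exprS (1 + u / M)) mulrA ler_wpM2r ?dominated_decay_step//.
by rewrite exprn_ge0// addr_ge0// divr_ge0// ltW.
Qed.

Lemma dominated_decay x t : 0 <= t ->
  `|hadjoint iK (dual_op (S t) x)| <= expR (- (t / (2 * M))) * `|hadjoint iK x|.
Proof.
move=> t0.
have : `|hadjoint iK (dual_op (S t) x)| ^+ 2 * expR (t / M) <= `|hadjoint iK x| ^+ 2.
  apply: mul_expR_le => [||n]; rewrite ?sqr_ge0 ?divr_ge0 ?(ltW M0)//.
  have := @dominated_decay_iter n.+1 x (t / n.+1%:R).
  rewrite divr_ge0// => /(_ isT).
  have -> : n.+1%:R * (t / n.+1%:R) = t by rewrite mulrC divfK.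
  by rewrite (mulrAC t).
rewrite -ler_pdivlMr ?expR_gt0// => h.
rewrite -(ler_pXn2r (n := 2)) ?nnegrE ?mulr_ge0 ?expR_ge0// exprMn.
apply: le_trans h _; rewrite mulrC -expRM_natl -expRN ler_wpM2r ?sqr_ge0// ler_expR.
by rewrite le_eqVlt; apply/orP; left; apply/eqP; field; rewrite gt_eqF.
Qed.

End domination.

Section contraction.
Hypothesis contr : forall x t, 0 <= t ->
  `|hadjoint iK (dual_op (S t) x)| <= expR (- (t / (2 * M))) * `|hadjoint iK x|.

(** The energy identity, with [1 - exp (- u) >= u / (1 + u)] for u = t / M. *)
Lemma decay_Qt_lower x t : 0 < t ->
  t / (M + t) * `|hadjoint iK x| ^+ 2 <= x (Qt S i t x).
Proof.
move=> t0.
have := adjoint_orbit_decay x (ltW t0).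
have : `|hadjoint iK (dual_op (S t) x)| ^+ 2 <= (M / (M + t)) * `|hadjoint iK x| ^+ 2.
  have := contr x (ltW t0).
  rewrite -(ler_pXn2r (n := 2)) ?nnegrE ?mulr_ge0 ?expR_ge0// exprMn -expRM_natl.
  move=> h; apply: le_trans h _; rewrite ler_wpM2r ?sqr_ge0//.
  have -> : 2%:R * - (t / (2 * M)) = - (t / M) by field; rewrite gt_eqF.
  have -> : M / (M + t) = (1 + t / M)^-1 by field; rewrite ?gt_eqF ?addr_gt0.
  by rewrite expRN lef_pV2 ?posrE ?expR_gt0 ?expR_ge1Dx// addr_gt0 ?divr_gt0.
have -> : t / (M + t) = 1 - M / (M + t) by field; rewrite gt_eqF// addr_gt0.
by move=> h1 h2; lra.
Qed.

(** For regular y the integrand of [y (Q_t y)] is at most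
    [(|i^* y| + C s)^2]; compare with the lower bound and let t tend to 0. *)
Lemma decay_regular_dominated y : regular S y ->
  `|hadjoint iK y| <= Num.sqrt M * `|hadjoint i y|.
Proof.
move=> [L L0 yL].
have [B [B0 HB]] := hadjoint_bound i.
pose a := `|hadjoint i y|; pose C := B * L.
have C0 : 0 <= C by rewrite mulr_ge0.
have bound s : 0 <= s <= 1 -> `|adj_orbit S i y s| <= a + C * s.
  move=> s01; have [z zE] := bop_lin y (dual_op (S s) y) (-1).
  have := hadjoint_lin i zE; rewrite scaleN1r => hz.
  have -> : adj_orbit S i y s = hadjoint i y + hadjoint i z.
    by rewrite hz addrA subrr add0r.
  rewrite (le_trans (ler_normD _ _))// lerD2l /C -mulrA; apply: HB.
    by rewrite mulr_ge0//; case/andP: s01.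
  by move=> v; rewrite zE scaleN1r addrC yL.
have key t : 0 < t <= 1 -> `|hadjoint iK y| ^+ 2 <= (M + t) * (a + C * t) ^+ 2.
  move=> /andP[t0 t1].
  have b s : 0 <= s <= t -> 0 <= `|adj_orbit S i y s| ^+ 2 <= (a + C * t) ^+ 2.
    move=> /andP[s0 st]; rewrite sqr_ge0/= ler_pXn2r ?nnegrE//; last first.
      by rewrite addr_ge0 ?mulr_ge0 ?(ltW t0)// normr_ge0.
    rewrite (le_trans (bound _ _)) ?s0 ?(le_trans st)//.
    by rewrite lerD2l ler_wpM2l.
  have /andP[_] := Qt_dual_bounds hS (ltW t0) b.
  move/(le_trans (decay_Qt_lower y t0)).
  rewrite -mulrA ler_pM2l// ler_pdivrMl ?addr_gt0//.
have lim : (fun n => (M + n.+1%:R^-1) * (a + C * n.+1%:R^-1) ^+ 2) @ \oo -->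
    M * a ^+ 2.
  have inv0 : (fun n => n.+1%:R^-1 : R) @ \oo --> (0 : R) by exact: cvg_harmonic.
  apply: cvgM.
    by rewrite -[X in _ --> X]addr0; apply: cvgD; [exact: cvg_cst|].
  have h : (fun n => a + C * n.+1%:R^-1) @ \oo --> a.
    rewrite -[X in _ --> X]addr0 -[X in _ --> _ + X](mulr0 C).
    by apply: cvgD; [exact: cvg_cst|exact: cvgMl_tmp].
  by under eq_fun do rewrite expr2; rewrite expr2; exact: cvgM.
rewrite -(ler_pXn2r (n := 2)) ?nnegrE ?mulr_ge0 ?sqrtr_ge0// exprMn.
rewrite sqr_sqrtr ?(ltW M0)//.
rewrite -/a; have h0 : (fun=> `|hadjoint iK y| ^+ 2) @ \oo --> `|hadjoint iK y| ^+ 2.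
  exact: cvg_cst.
apply: (ler_cvg_to h0 lim); apply: nearW => n; apply: key.
by rewrite invr_gt0 ltr0n/= invf_le1// ler1n.
Qed.

(** For w = [iK^* x], the estimate on regular functionals and [riesz_along]
    provide h in H with [|h| <= sqrt M |w|] that regular functionals, hence all
    functionals, cannot tell apart from w.  Thus [|w|^2 = x (iK w) = x (i h)] is at
    most [|i^* x| |h|]. *)
Lemma decay_dominated x : `|hadjoint iK x| ^+ 2 <= M * `|hadjoint i x| ^+ 2.
Proof.
pose w := hadjoint iK x.
have [y0 ry0 _] := regular_dense hS x 0 ltr01.
have [|y|| h [hM hE]] := @riesz_along R H {y | regular S y}
  (fun y => hadjoint i (sval y))
  (fun y => inner (hadjoint iK (sval y)) w) (exist _ y0 ry0) (Num.sqrt M * `|w|).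
- move=> a [y ry] [z rz] /=; have [u uE] := bop_lin y z a.
  exists (exist _ u (regular_lin ry rz uE)) => /=.
  by rewrite !(hadjoint_lin _ uE) innerDl innerZl.
- rewrite (le_trans (cauchy_schwarz _ _))// mulrAC ler_wpM2r//.
  exact: decay_regular_dominated (svalP y).
- by rewrite mulr_ge0 ?sqrtr_ge0.
have ihw : x (i h) = x (iK w).
  apply/subr0_eq; rewrite -linearB; set v := i h - iK w.
  apply/eqP; rewrite -normr_le0; apply/ler_addgt0Pr => e e0; rewrite add0r.
  have [y ry] := regular_dense hS x v e0.
  have -> : y v = 0; last by rewrite sub0r normrN.
  have := hE (exist _ y ry); rewrite /= innerC !hadjointE => yE.
  by rewrite /v linearB yE subrr.
have : `|w| ^+ 2 <= Num.sqrt M * `|w| * `|hadjoint i x|.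
  rewrite -inner_norm {1}/w hadjointE -ihw -hadjointE.
  rewrite (le_trans (ler_norm _))// (le_trans (cauchy_schwarz _ _))//.
  by rewrite mulrC ler_wpM2r.
have [w0|w0] := eqVneq `|w| 0.
  by move=> _; rewrite -/w w0 expr0n mulr_ge0 ?sqr_ge0// ltW.
have wp : 0 < `|w| by rewrite lt0r w0 normr_ge0.
move=> h1; rewrite expr2 mulrAC ler_pM2r// in h1.
rewrite -/w -(sqr_sqrtr (ltW M0)) -exprMn ler_pXn2r ?nnegrE ?mulr_ge0 ?sqrtr_ge0//.
Qed.

End contraction.
End equivalence.

Theorem lemma5p2 (R : realType) (E : completeNormedModType R)
    (S : R -> bounded_op E E) (hS : C0_semigroup S)
    (H : hilbertType R) (i : bounded_op H E) (hi : injective i)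
    (hQ : forall x : dual E, exists v, weak_lim (fun t => Qt S i t x) v)
    (Hinf : hilbertType R) (iinf : bounded_op Hinf E)
    (hHinf : is_rkhs (Qinf S i) iinf)
    (M : R) (hM : 0 < M) :
  (forall x : dual E, x (Qinf S i x) <= M * x (Qop i x)) <->
  (forall t : R, 0 <= t ->
     (opnorm (restriction iinf (S t)) <= (expR (- (t / (2 * M))))%:E)%E).
Proof.
have iinf_inj := rkhs_inj hHinf.
have QE x : Qinf S i x = Qop iinf x := rkhs_factor hHinf x.
have Qcvg (x : dual E) : x (Qt S i t x) @[t --> +oo] --> `|hadjoint iinf x| ^+ 2.
  rewrite -dual_Qop -QE.
  have : weak_lim (Qt S i ^~ x) (Qinf S i x) by exact: (xgetPex 0 (hQ x)).
  exact.
split=> [h1 t t0|h2 x].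
  apply/(opnorm_restriction hS iinf_inj Qcvg (expR_ge0 _) t0) => x.
  apply: (dominated_decay hS Qcvg hM) => // y.
  by rewrite -!dual_Qop -QE.
rewrite QE !dual_Qop; apply: (decay_dominated hS Qcvg hM) => y t t0.
exact: ((opnorm_restriction hS iinf_inj Qcvg (expR_ge0 _) t0).1 (h2 t t0)).
Qed.
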